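(* Let $\mathcal H$ be a Hopf algebra over $\mathbf C$, $\mathcal X\subset\mathcal H$ a subalgebra and left coideal (i.e. $\Delta(\mathcal X)\subset\mathcal H\otimes\mathcal X$), and let $e^1,\dots,e^M$ be a fixed basis of a subcomodule of $\mathcal X$, so that $\Delta(e^i)=\sum_j\pi^i_j\otimes e^j$ with unique $\pi^i_j\in\mathcal H$. For a covariant first order differential calculus $(\Gamma,\mathrm d)$ on $\mathcal X$ consider the condition (F) for every $a\in\mathcal X$ there are unique $a_1,\dots,a_M\in\mathcal X$ with $\mathrm da=a_1\,\mathrm de^1+\cdots+a_M\,\mathrm de^M$. If (F) holds, define $\partial_i:\mathcal X\to\mathcal X$ by $\mathrm da=\sum_i\partial_i(a)\,\mathrm de^i$. Then the assignment of the set $\{\varepsilon\circ\partial_1,\dots,\varepsilon\circ\partial_M\}$ to $(\Gamma,\mathrm d)$ establishes a one-to-one correspondence between - the (isomorphism classes of) covariant first order differential calculi on $\mathcal X$ satisfying condition (F), and - the subsets $\{\chi_1,\dots,\chi_M\}$ of the restricted dual $\mathcal X^\circ$ for which $\mathrm{Lin}\{\varepsilon,\chi_1,\dots,\chi_M\}$ is a right coideal of $\mathcal X^\circ$, $\chi_i(e^j)=\delta_{ij}$, $\chi_i(1)=0$, and $\partial_i(\mathcal X)\subset\mathcal X$ for all $i$, where $\partial_1,\dots,\partial_M:\mathcal X\to\mathcal H$ are defined by $$\partial_i(a)=\sum_j a_{(1)}\,\chi_j(a_{(2)})\,S(\pi^j_i).$$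
   Context: Algebras and subalgebras are unital. $\mathcal H$ has comultiplication $\Delta$, counit $\varepsilon$ (its restriction to $\mathcal X$ is also denoted $\varepsilon$), antipode $S$; Sweedler notation $\Delta(a)=a_{(1)}\otimes a_{(2)}$ is used. $\mathcal X$ is a left $\mathcal H$-comodule via $\Delta$. The elements $\pi^i_j$ satisfy $\Delta(\pi^i_j)=\sum_k\pi^i_k\otimes\pi^k_j$, $\varepsilon(\pi^i_j)=\delta_{ij}$. A first order differential calculus on $\mathcal X$ is a pair $(\Gamma,\mathrm d)$ of an $\mathcal X$-bimodule $\Gamma$ and a linear map $\mathrm d:\mathcal X\to\Gamma$ with $\mathrm d(ab)=\mathrm da\,b+a\,\mathrm db$ and $\Gamma=\mathrm{Lin}\{a\,\mathrm db\mid a,b\in\mathcal X\}$. It is covariant if the linear map $\Delta_\Gamma:\Gamma\to\mathcal H\otimes\Gamma$, $a\,\mathrm db\mapsto a_{(1)}b_{(1)}\otimes a_{(2)}\,\mathrm db_{(2)}$, is well-defined. Calculi $(\Gamma,\mathrm d)$, $(\Gamma',\mathrm d')$ are isomorphic if there is a bimodule isomorphism $\Gamma\to\Gamma'$ sending $\mathrm da$ to $\mathrm d'a$ for all $a\in\mathcal X$; calculi are viewed only up to isomorphism. The restricted dual $\mathcal A^\circ$ of an algebra $\mathcal A$ consists of those linear functionals $f$ on $\mathcal A$ for which there are finitely many functionals $f_i,f^i$ on $\mathcal A$ with $f(ab)=\sum_if_i(a)f^i(b)$ for all $a,b\in\mathcal A$; it is a coalgebra with $\Delta(f)=\sum_if_i\otimes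 f^i$. A right coideal of $\mathcal A^\circ$ is a linear subspace $W$ with $\Delta(W)\subset W\otimes\mathcal A^\circ$. *)

(* Defs.v *)
From HB Require Import structures.
From mathcomp Require Import all_boot all_order all_algebra.
From mathcomp Require Import boolp classical_sets functions reals.
From mathcomp Require Import complex.

Set Implicit Arguments.
Unset Strict Implicit.
Unset Printing Implicit Defensive.

Import GRing.Theory.
Local Open Scope ring_scope.
Local Open Scope classical_set_scope.
Local Open Scope quotient_scope.

Reserved Notation "u \ox v" (at level 40, left associativity).

Section Lin.
Variables (K : fieldType) (V : lmodType K).

Definition Lin (S : set V) : set V := [set v | exists n (c : 'I_n -> K)
  (x : 'I_n -> V), (forall i, S (x i)) /\ v = \sum_i c i *: x i].

Definition subspace (S : set V) : Prop :=
  S 0 /\ forall (a : K) u v, S u -> S v -> S (a *: u + v).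

Definition is_basis (S : set V) M (e : 'I_M -> V) : Prop :=
  Lin (range e) = S /\
  forall c : 'I_M -> K, \sum_i c i *: e i = 0 -> forall i, c i = 0.

End Lin.

(* The tensor product over K: formal sums of pairs, written as lists, modulo
   the congruence generated by bilinearity; the list [:: (u1, v1); (u2, v2)]
   stands for u1 \ox v1 + u2 \ox v2. *)
Section Tensor.
Variables (K : fieldType) (U V : lmodType K).

Inductive tens_eq : seq (U * V) -> seq (U * V) -> Prop :=
| tens_refl s : tens_eq s s
| tens_sym s t : tens_eq s t -> tens_eq t s
| tens_trans s t r : tens_eq s t -> tens_eq t r -> tens_eq s r
| tens_cat s s' t t' :
    tens_eq s s' -> tens_eq t t' -> tens_eq (s ++ t) (s' ++ t')
| tens_catC s t : tens_eq (s ++ t) (t ++ s)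
| tens_0l v : tens_eq [:: (0, v)] [::]
| tens_Dl u u' v : tens_eq [:: (u + u', v)] [:: (u, v); (u', v)]
| tens_Dr u v v' : tens_eq [:: (u, v + v')] [:: (u, v); (u, v')]
| tens_Z a u v : tens_eq [:: (a *: u, v)] [:: (u, a *: v)].

Definition tens_eqb (s t : seq (U * V)) : bool := `[< tens_eq s t >].

Fact tens_eqb_refl : reflexive tens_eqb.
Proof. by move=> s; apply/asboolP/tens_refl. Qed.
Fact tens_eqb_sym : symmetric tens_eqb.
Proof. by move=> s t; apply/asboolP/asboolP; exact: tens_sym. Qed.
Fact tens_eqb_trans : transitive tens_eqb.
Proof.
by move=> s t r /asboolP ts /asboolP sr; apply/asboolP/(tens_trans ts sr).
Qed.
Canonical tens_equiv :=
  EquivRel tens_eqb tens_eqb_refl tens_eqb_sym tens_eqb_trans.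

Definition tensor : Type := {eq_quot tens_equiv}.
HB.instance Definition _ := Choice.on tensor.
HB.instance Definition _ := EqQuotient.on tensor.

Let cls (s : seq (U * V)) : tensor := \pi s.

Lemma tens_piP s t : (cls s = cls t) <-> tens_eq s t.
Proof.
split=> [/eqP | st]; first by rewrite eqmodE => /asboolP.
by apply/eqP; rewrite eqmodE; apply/asboolP.
Qed.

Lemma tens_reprP s : tens_eq (repr (cls s)) s.
Proof. by apply/tens_piP; rewrite /cls reprK. Qed.

Definition scale_seq (a : K) (s : seq (U * V)) :=
  [seq (a *: p.1, p.2) | p <- s].

Lemma scale_seq_eq a s t :
  tens_eq s t -> tens_eq (scale_seq a s) (scale_seq a t).
Proof.
elim=> {s t}; rewrite /scale_seq.
- by move=> s; exact: tens_refl.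
- by move=> s t _; exact: tens_sym.
- by move=> s t r _ st _; exact: tens_trans.
- by move=> s s' t t' _ ss' _ tt'; rewrite !map_cat; exact: tens_cat.
- by move=> s t; rewrite !map_cat; exact: tens_catC.
- by move=> v /=; rewrite scaler0; exact: tens_0l.
- by move=> u u' v /=; rewrite scalerDr; exact: tens_Dl.
- by move=> u v v' /=; exact: tens_Dr.
- by move=> b u v /=; rewrite scalerA mulrC -scalerA; exact: tens_Z.
Qed.

Definition tens_add (x y : tensor) : tensor := cls (repr x ++ repr y).
Definition tens_scale (a : K) (x : tensor) : tensor :=
  cls (scale_seq a (repr x)).
Definition tens_opp (x : tensor) : tensor := tens_scale (-1) x.

Let addE s t : tens_add (cls s) (cls t) = cls (s ++ t).
Proof. by apply/tens_piP/tens_cat; exact: tens_reprP. Qed.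

Let scaleE a s : tens_scale a (cls s) = cls (scale_seq a s).
Proof. by apply/tens_piP/scale_seq_eq/tens_reprP. Qed.

Let clsP x : exists s, x = cls s.
Proof. by exists (repr x); rewrite /cls reprK. Qed.

Let scale_seqDl a b s :
  tens_eq (scale_seq (a + b) s) (scale_seq a s ++ scale_seq b s).
Proof.
elim: s => [|[u v] s IH] /=; first exact: tens_refl.
rewrite scalerDl.
apply: (@tens_trans _ ([:: (a *: u, v); (b *: u, v)] ++
  (scale_seq a s ++ scale_seq b s))).
  by rewrite -cat1s; apply: tens_cat IH; exact: tens_Dl.
rewrite -[X in tens_eq _ X]/([:: (a *: u, v)] ++
  (scale_seq a s ++ ([:: (b *: u, v)] ++ scale_seq b s))).
rewrite -[X in tens_eq X _]/([:: (a *: u, v)] ++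
  ([:: (b *: u, v)] ++ (scale_seq a s ++ scale_seq b s))).
apply: tens_cat; first exact: tens_refl.
rewrite !(catA _ _ (scale_seq b s)); apply: tens_cat; last exact: tens_refl.
exact: tens_catC.
Qed.

Let scale_seq0 s : tens_eq (scale_seq 0 s) [::].
Proof.
elim: s => [|[u v] s IH] /=; first exact: tens_refl.
rewrite scale0r -cat1s -[X in tens_eq _ X]cats0.
by apply: tens_cat IH; exact: tens_0l.
Qed.

Fact tens_addA : associative tens_add.
Proof.
move=> x y z; have [[[s ->] [t ->]] [r ->]] := (clsP x, clsP y, clsP z).
by rewrite !addE catA.
Qed.

Fact tens_addC : commutative tens_add.
Proof.
move=> x y; have [[s ->] [t ->]] := (clsP x, clsP y).
by rewrite !addE; apply/tens_piP/tens_catC.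
Qed.

Fact tens_add0 : left_id (cls [::]) tens_add.
Proof. by move=> x; have [s ->] := clsP x; rewrite addE. Qed.

Fact tens_addN : left_inverse (cls [::]) tens_opp tens_add.
Proof.
move=> x; have [s ->] := clsP x; rewrite /tens_opp scaleE addE; apply/tens_piP.
apply: (@tens_trans _ (scale_seq (-1) s ++ scale_seq 1 s)).
  apply: tens_cat; first exact: tens_refl.
  have -> : scale_seq 1 s = s; last exact: tens_refl.
  by rewrite -[RHS]map_id; apply: eq_map => -[u v]; rewrite /= scale1r.
apply: tens_trans (tens_sym (scale_seqDl _ _ _)) _.
by rewrite addNr; exact: scale_seq0.
Qed.

HB.instance Definition _ :=
  GRing.isZmodule.Build tensor tens_addA tens_addC tens_add0 tens_addN.

Let add_cls s t : cls s + cls t = cls (s ++ t).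
Proof. exact: addE. Qed.

Fact tens_scaleA a b x : tens_scale a (tens_scale b x) = tens_scale (a * b) x.
Proof.
have [s ->] := clsP x; rewrite !scaleE /scale_seq -map_comp; congr cls.
by apply: eq_map => -[u v] /=; rewrite scalerA.
Qed.

Fact tens_scale1 : left_id 1 tens_scale.
Proof.
move=> x; have [s ->] := clsP x; rewrite scaleE; congr cls.
by rewrite -[RHS]map_id; apply: eq_map => -[u v]; rewrite /= scale1r.
Qed.

Fact tens_scaleDr : right_distributive tens_scale +%R.
Proof.
move=> a x y; have [[s ->] [t ->]] := (clsP x, clsP y).
by rewrite add_cls !scaleE add_cls /scale_seq map_cat.
Qed.

Fact tens_scaleDl x : {morph tens_scale^~ x : a b / a + b}.
Proof.
move=> a b; have [s ->] := clsP x.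
by rewrite !scaleE add_cls; apply/tens_piP/scale_seqDl.
Qed.

HB.instance Definition _ := GRing.Zmodule_isLmodule.Build K tensor
  tens_scaleA tens_scale1 tens_scaleDr tens_scaleDl.

Let scale_cls a s : a *: cls s = cls (scale_seq a s).
Proof. exact: scaleE. Qed.

Definition tens (u : U) (v : V) : tensor := cls [:: (u, v)].

(* tlift B (u_1 \ox v_1 + ... + u_n \ox v_n) = B u_1 v_1 + ... + B u_n v_n, the
   linear map induced by a bilinear B.  It is defined for any B by means of a
   chosen representative, which is irrelevant when B is bilinear (tlift_tens,
   tlift_linear); it is only ever applied to bilinear B. *)
Definition tlift (W : lmodType K) (B : U -> V -> W) (t : tensor) : W :=
  \sum_(p <- repr t) B p.1 p.2.

Definition bilinear_map (W : lmodType K) (B : U -> V -> W) : Prop :=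
  (forall v, linear (B^~ v)) /\ (forall u, linear (B u)).

Section Lift.
Variables (W : lmodType K) (B : U -> V -> W).
Hypothesis bilB : bilinear_map B.

Let BDl u u' v : B (u + u') v = B u v + B u' v.
Proof. by have := bilB.1 v 1 u u'; rewrite !scale1r. Qed.
Let BDr u v v' : B u (v + v') = B u v + B u v'.
Proof. by have := bilB.2 u 1 v v'; rewrite !scale1r. Qed.
Let B0l v : B 0 v = 0.
Proof. by apply: (@addrI _ (B 0 v)); rewrite -BDl !addr0. Qed.
Let B0r u : B u 0 = 0.
Proof. by apply: (@addrI _ (B u 0)); rewrite -BDr !addr0. Qed.
Let BZl a u v : B (a *: u) v = a *: B u v.
Proof. by have := bilB.1 v a u 0; rewrite !addr0 B0l addr0. Qed.
Let BZr a u v : B u (a *: v) = a *: B u v.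
Proof. by have := bilB.2 u a v 0; rewrite !addr0 B0r addr0. Qed.

Let lift_eq s t : tens_eq s t ->
  \sum_(p <- s) B p.1 p.2 = \sum_(p <- t) B p.1 p.2.
Proof.
elim=> {s t} //.
- by move=> s t r _ -> _ ->.
- by move=> s s' t t' _ ss' _ tt'; rewrite !big_cat /= ss' tt'.
- by move=> s t; rewrite !big_cat /= addrC.
- by move=> v; rewrite big_cons !big_nil /= B0l addr0.
- by move=> u u' v; rewrite !big_cons !big_nil /= !addr0 BDl.
- by move=> u v v'; rewrite !big_cons !big_nil /= !addr0 BDr.
- by move=> a u v; rewrite !big_seq1 /= BZl BZr.
Qed.

Lemma tlift_tens u v : tlift B (tens u v) = B u v.
Proof. by rewrite /tlift (lift_eq (tens_reprP _)) big_seq1. Qed.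

Lemma tlift_linear : linear (tlift B).
Proof.
move=> a x y; have [[s ->] [t ->]] := (clsP x, clsP y).
rewrite scale_cls add_cls /tlift.
rewrite !(lift_eq (tens_reprP _)) big_cat big_map /= scaler_sumr.
by congr (_ + _); apply: eq_bigr => p _; rewrite BZl.
Qed.

End Lift.

Lemma tens_bilinear : bilinear_map tens.
Proof.
split=> [v a u u' | u a v v']; rewrite /tens.
  rewrite scale_cls add_cls; exact/tens_piP/tens_Dl.
rewrite scale_cls add_cls; apply/tens_piP/(tens_trans (tens_Dr _ _ _)).
apply: (@tens_cat [:: _] [:: _] [:: _] [:: _]); last exact: tens_refl.
exact/tens_sym/tens_Z.
Qed.

Lemma tensorP (t : tensor) : exists s : seq (U * V),
  t = \sum_(p <- s) tens p.1 p.2.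
Proof.
have [s ->] := clsP t; exists s; elim: s => [|p s IH]; first by rewrite big_nil.
by rewrite big_cons -IH -cat1s -add_cls; case: p.
Qed.

End Tensor.

Notation "u \ox v" := (tens u v) : ring_scope.

Definition tmap (K : fieldType) (U V U' V' : lmodType K)
    (f : U -> U') (g : V -> V') : tensor U V -> tensor U' V' :=
  tlift (fun u v => f u \ox g v).

Definition tassoc (K : fieldType) (U V W : lmodType K) :
    tensor (tensor U V) W -> tensor U (tensor V W) :=
  tlift (fun t w => tlift (fun u v => u \ox (v \ox w)) t).

Definition tmul (K : fieldType) (A B : algType K) (s t : tensor A B) :
    tensor A B :=
  tlift (fun a b => tlift (fun a' b' => (a * a') \ox (b * b')) t) s.

Record hopf_algebra (K : fieldType) (H : algType K) := HopfAlgebra {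
  comul : {linear H -> tensor H H};
  counit : {lrmorphism H -> K^o};
  antipode : {linear H -> H};
  comul1 : comul 1 = 1 \ox 1;
  comulM : forall a b, comul (a * b) = tmul (comul a) (comul b);
  comulA : forall a,
    tassoc (tmap comul idfun (comul a)) = tmap idfun comul (comul a);
  counitl : forall a, tlift (fun x y => (counit x : K) *: y) (comul a) = a;
  counitr : forall a, tlift (fun x y => (counit y : K) *: x) (comul a) = a;
  antipodel : forall a,
    tlift (fun x y => antipode x * y) (comul a) = (counit a : K)%:A;
  antipoder : forall a,
    tlift (fun x y => x * antipode y) (comul a) = (counit a : K)%:A
}.

Section RestrictedDual.
Variables (K : fieldType) (A : algType K).

Definition restricted (f : A -> K^o) : Prop :=
  linear f /\ exists n (g h : 'I_n -> A -> K^o),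
    [/\ forall k, linear (g k), forall k, linear (h k) &
        forall a b, f (a * b) = \sum_k g k a * h k b].

Definition restricted_pred : pred (A -> K^o) := [pred f | `[< restricted f >]].

Fact restricted_closed : submod_closed restricted_pred.
Proof.
split=> [|c f f'].
  apply/asboolP; split; first by move=> c u v; rewrite scaler0 addr0.
  exists 0%N, (fun _ _ => 0), (fun _ _ => 0).
  by split=> [[]|[]|a b] //; rewrite big_ord0.
move=> /asboolP[lf [n [g [h [lg lh fE]]]]].
move=> /asboolP[lf' [n' [g' [h' [lg' lh' fE']]]]].
apply/asboolP; split.
  move=> d u v; rewrite !fctE lf lf' !scalerDr !scalerA [c * d]mulrC.
  by rewrite addrACA.
exists (n + n')%N.
exists (fun k : 'I_(n + n') =>
  match fintype.split k with inl i => c *: g i | inr j => g' j end).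
exists (fun k : 'I_(n + n') =>
  match fintype.split k with inl i => h i | inr j => h' j end).
split=> [k|k|a b].
- case: (fintype.split k) => // i d u v; rewrite !fctE lg scalerDr !scalerA.
  by rewrite [c * d]mulrC.
- by case: (fintype.split k).
- rewrite !fctE fE fE' big_split_ord /= scaler_sumr.
  congr (_ + _); apply: eq_bigr => i _.
    by rewrite (unsplitK (inl i)) fctE scalerAl.
  by rewrite (unsplitK (inr i)).
Qed.

HB.instance Definition _ := GRing.isSubmodClosed.Build K (A -> K^o)
  restricted_pred restricted_closed.

Record rdual := RDual { rdual_val :> A -> K^o; _ : restricted_pred rdual_val }.
HB.instance Definition _ := [isSub for rdual_val].
HB.instance Definition _ := [Choice of rdual by <:].
HB.instance Definition _ := [SubChoice_isSubLmodule of rdual by <:].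

(* t = Delta f: the identity f (a * b) = \sum_k f_k a * f^k b characterises
   Delta f = \sum_k f_k \ox f^k in the tensor square of the restricted dual. *)
Definition is_rdual_comul (f : rdual) (t : tensor rdual rdual) : Prop :=
  forall a b, tlift (fun g h : rdual => (g a : K) *: h b) t = f (a * b).

Definition right_coideal (W : set (A -> K^o)) : Prop :=
  [/\ W `<=` restricted, subspace W &
      forall f : rdual, W f -> exists t : tensor rdual rdual,
        is_rdual_comul f t /\
        Lin [set s | exists w g : rdual, W w /\ s = w \ox g] t].

End RestrictedDual.

Record bimodule (K : fieldType) (A : algType K) := Bimodule {
  bimod_sort :> lmodType K;
  lact : A -> bimod_sort -> bimod_sort;
  ract : bimod_sort -> A -> bimod_sort;
  lact_bilinear : bilinear_map lact;
  ract_bilinear : bilinear_map ract;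
  lact1 : forall w, lact 1 w = w;
  ract1 : forall w, ract w 1 = w;
  lactM : forall a b w, lact (a * b) w = lact a (lact b w);
  ractM : forall a b w, ract w (a * b) = ract (ract w a) b;
  lractA : forall a w b, ract (lact a w) b = lact a (ract w b)
}.
Arguments lact {K A b} : rename.
Arguments ract {K A b} : rename.

Record fodc (K : fieldType) (A : algType K) := Fodc {
  fodc_bimod :> bimodule A;
  diff : {linear A -> fodc_bimod};
  diffM : forall a b, diff (a * b) = ract (diff a) b + lact a (diff b);
  fodc_span : forall w,
    Lin [set v | exists a b, v = lact a (diff b)] w
}.
Arguments diff {K A} f : rename.

Definition fodc_iso (K : fieldType) (A : algType K) (G G' : fodc A) : Prop :=
  exists phi : {linear G -> G'},
    [/\ bijective phi,
        forall a w, phi (lact a w) = lact a (phi w),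
        forall w a, phi (ract w a) = ract (phi w) a &
        forall a, phi (diff G a) = diff G' a].

Section Coideal.
Variables (K : fieldType) (H : algType K) (hopf : hopf_algebra H).
Variables (P : pred H) (X : subAlgType P).

(* H \ox X is viewed inside H \ox H along id \ox val, which is injective since
   K is a field. *)
Definition left_coideal : Prop :=
  forall x : X, exists t : tensor H X,
    tmap idfun val t = comul hopf (val x).

Hypothesis coidX : left_coideal.

Definition coaction (x : X) : tensor H X := sval (cid (coidX x)).

Definition subcomodule (V : set X) : Prop :=
  subspace V /\ forall v, V v ->
    Lin [set t | exists h w, V w /\ t = h \ox w] (coaction v).

Definition counit_on (x : X) : K^o := counit hopf (val x).

Definition covariant (G : fodc X) : Prop :=
  exists D : {linear G -> tensor H G}, forall a b : X,
    D (lact a (diff G b)) =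
    tlift (fun h x => tlift (fun h' y => (h * h') \ox lact x (diff G y))
      (coaction b)) (coaction a).

Section Basis.
Variables (M : nat) (e : 'I_M -> X).

Definition condF (G : fodc X) : Prop :=
  forall a, exists! c : {ffun 'I_M -> X},
    diff G a = \sum_i lact (c i) (diff G (e i)).

Definition partial (G : fodc X) (GF : condF G) (i : 'I_M) (a : X) : X :=
  sval (cid (GF a)) i.

Definition functionals (G : fodc X) (GF : condF G) : set (X -> K^o) :=
  range (fun i => counit_on \o partial GF i).

Variable pi : 'I_M -> 'I_M -> H.

Definition partial_of (chi : 'I_M -> X -> K^o) (i : 'I_M) (a : X) : H :=
  \sum_j tlift (fun h x => (chi j x : K) *: (h * antipode hopf (pi j i)))
    (coaction a).

Definition admissible (W : set (X -> K^o)) : Prop :=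
  exists2 chi : 'I_M -> X -> K^o, W = range chi &
  [/\ forall i, restricted (chi i),
      right_coideal (Lin (counit_on |` range chi)),
      forall i j, chi i (e j) = (i == j)%:R,
      forall i, chi i 1 = 0 &
      forall i a, partial_of chi i a \in P].

End Basis.
End Coideal.

(* Main.v *)
(* Under (F) the de^i form a basis of Gamma as a left X-module.  Comparing the
   coefficients of Delta_Gamma(da), computed from a and from sum_i d_i(a) de^i,
   and applying id \ox eps gives
     sum_i d_i(a) pi^i_k = a_(1) chi_k(a_(2)),   chi_k = eps o d_k,   (1)
   and multiplying by the inverse matrix S(pi) recovers d_i, hence the whole
   calculus, from chi.  The Leibniz rule reads
     d_j(ab) = sum_i d_i(a) t^i_j(b) + a d_j(b),
     t^i_j(b) = d_j(e^i b) - e^i d_j(b),                              (2)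
   and its image under eps is the right coideal condition.  Conversely the right
   coideal condition implies (2) for the d_i defined from chi; expanding
   d_j(e^i a b) in two ways then gives t(ab) = t(a) t(b) and t(1) = 1, so that t
   defines a right action on the free module X^M, with da = (d_i(a))_i.
   Covariance follows by applying Delta to (1). *)
From HB Require Import structures.
Require Import Defs.
From mathcomp Require Import all_boot all_order all_algebra.
From mathcomp Require Import boolp classical_sets functions reals.
From mathcomp Require Import complex.

Set Implicit Arguments.
Unset Strict Implicit.
Unset Printing Implicit Defensive.

Import GRing.Theory.
Local Open Scope ring_scope.
Local Open Scope classical_set_scope.

(** * Linear maps given as bare functions, and linear spans *)

Section LinearSpan.
Variables (K : fieldType) (V W : lmodType K).

(** Maps induced by bilinear ones come as bare functions with a proof of linearity; bundling them
    gives access to the general rules for linear maps. *)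
Lemma linear_pack (f : V -> W) : linear f -> exists g : {linear V -> W}, g =1 f.
Proof.
move=> lf; pose mf := GRing.isLinear.Build K V W _ f lf.
by exists (HB.pack f mf : {linear V -> W}).
Qed.

Lemma linear_of_linfun (f : {linear V -> W}) : linear f.
Proof. by move=> a u v; rewrite linearP. Qed.

Lemma linear_map0 (f : V -> W) : linear f -> f 0 = 0.
Proof. by case/linear_pack=> g <-; rewrite linear0. Qed.

Lemma linear_mapD (f : V -> W) : linear f -> {morph f : u v / u + v}.
Proof. by case/linear_pack=> g gE u v; rewrite -!gE linearD. Qed.

Lemma linear_mapZ (f : V -> W) a : linear f -> {morph f : u / a *: u}.
Proof. by case/linear_pack=> g gE u; rewrite -!gE linearZ. Qed.

Lemma linear_map_sum (f : V -> W) (I : Type) (r : seq I) (Q : pred I)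
    (F : I -> V) :
  linear f -> f (\sum_(i <- r | Q i) F i) = \sum_(i <- r | Q i) f (F i).
Proof.
case/linear_pack=> g gE; rewrite -gE linear_sum.
by apply: eq_bigr => i _; rewrite gE.
Qed.

Lemma linear_sum_fun (I : Type) (r : seq I) (F : I -> V -> W) :
  (forall i, linear (F i)) -> linear (fun v => \sum_(i <- r) F i v).
Proof.
move=> lF a u v; rewrite scaler_sumr -big_split /=.
by apply: eq_bigr => i _; rewrite lF.
Qed.

Lemma subspace_Lin (S : set V) : subspace (Lin S).
Proof.
split=> [|a u v].
  exists 0%N, (fun _ => 0), (fun _ => 0); split=> [[]|] //.
  by rewrite big_ord0.
move=> [n [c [x [xS ->]]]] [n' [c' [x' [xS' ->]]]].
exists (n + n')%N.
exists (fun k =>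
  match fintype.split k with inl i => a * c i | inr j => c' j end).
exists (fun k => match fintype.split k with inl i => x i | inr j => x' j end).
split=> [k|]; first by case: (fintype.split k).
rewrite big_split_ord /= scaler_sumr; congr (_ + _); apply: eq_bigr => i _.
  by rewrite (unsplitK (inl i)) scalerA.
by rewrite (unsplitK (inr i)).
Qed.

Lemma Lin_subset (S : set V) : S `<=` Lin S.
Proof.
move=> v Sv; exists 1%N, (fun _ => 1), (fun _ => v).
by split=> //; rewrite big_ord1 scale1r.
Qed.

Lemma subspace_sum (S : set V) n (c : 'I_n -> K) (x : 'I_n -> V) :
  subspace S -> (forall i, S (x i)) -> S (\sum_i c i *: x i).
Proof.
move=> [S0 SD] Sx; apply: (big_ind S) => // [u v Su Sv|i _].
  by have := SD 1 u v Su Sv; rewrite scale1r.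
by have := SD (c i) (x i) 0 (Sx i) S0; rewrite addr0.
Qed.

(** Serves as induction on spans: a property that defines a subspace only has to be checked on the
    generators. *)
Lemma Lin_min (S T : set V) : subspace T -> S `<=` T -> Lin S `<=` T.
Proof.
by move=> sT ST v [n [c [x [xS ->]]]]; apply: subspace_sum => // i; exact: ST.
Qed.

End LinearSpan.

(** * Splitting of injective linear maps *)

Section Retraction.
Variables (K : fieldType) (V W : lmodType K) (i : {linear V -> W}).
Hypothesis i_inj : injective i.

Let disjoint_from_image (N : set W) :=
  (forall a u v, N u -> N v -> N (a *: u + v)) /\
  (forall x, N (i x) -> i x = 0).

(* A maximal subspace meeting the image of i trivially is a complement of it;
   the empty set is allowed here because it is the union of the empty chain. *)
Lemma linear_retraction : exists r : {linear W -> V}, cancel i r.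
Proof.
have [|N0 [[N0D N0i] N0max]] := @Zorn_bigcup W disjoint_from_image.
  move=> F FP Ftot; split=> [a u v [A FA Au] [B FB Bv]|x [A FA Ax]].
    case: (Ftot _ _ FA FB) => [AB|BA].
      by exists B => //; apply: (FP _ FB).1 => //; exact: AB.
    by exists A => //; apply: (FP _ FA).1 => //; exact: BA.
  exact: (FP _ FA).2.
have N00 : N0 0.
  apply: contrapT => N0'.
  have N0E u : ~ N0 u.
    by move=> N0u; apply: N0'; rewrite -(addNr u) -scaleN1r; exact: N0D.
  apply: (N0max [set 0]).
    by split=> [u /N0E|sub] //; apply/N0'/sub.
  by split=> [a u v -> ->|x]; rewrite ?scaler0 ?addr0.
have N0Z a u : N0 u -> N0 (a *: u).
  by move=> N0u; rewrite -[_ *: _]addr0; exact: N0D.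
have dec w : exists x, N0 (w - i x).
  apply: contrapT => wN.
  (* If [w] were outside [N0] plus the image of [i], adding the line through [w] to [N0] would still
     meet that image trivially, against maximality. *)
  pose N1 := [set u | exists a v, N0 v /\ u = a *: w + v].
  apply: (N0max N1).
    split=> [u N0u|sub]; first by exists 0, u; rewrite scale0r add0r.
    apply: wN; exists 0; rewrite linear0 subr0; apply: sub.
    by exists 1, 0; rewrite scale1r addr0.
  split=> [a u v [b [u' [N0u ->]]] [c [v' [N0v ->]]]|x [a [v [N0v ixE]]]].
    exists (a * b + c), (a *: u' + v'); split; first exact: N0D.
    by rewrite scalerDr scalerDl scalerA addrACA.
  have [a0|a_neq0] := eqVneq a 0.
    by apply: N0i; rewrite ixE a0 scale0r add0r.
  case: wN; exists (a^-1 *: x).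
  rewrite linearZ /= ixE scalerDr scalerA mulVf // scale1r opprD addNKr.
  by rewrite -scaleNr; exact: N0Z.
pose r w := sval (cid (dec w)).
have rE w : N0 (w - i (r w)) by rewrite /r; case: cid.
have r_uniq w x : N0 (w - i x) -> r w = x.
  move=> N0x; apply/i_inj/eqP; rewrite -subr_eq0 -linearB; apply/eqP/N0i.
  rewrite linearB.
  have -> : i (r w) - i x = (-1) *: (w - i (r w)) + (w - i x).
    by rewrite scaleN1r opprB addrA subrK.
  exact: N0D.
have lr : linear r.
  move=> a u v; apply: r_uniq.
  have -> : a *: u + v - i (a *: r u + r v)
          = a *: (u - i (r u)) + (v - i (r v)).
    by rewrite linearP scalerBr opprD addrACA.
  exact: N0D.
have [g gE] := linear_pack lr; exists g => x; rewrite gE; apply: r_uniq.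
by rewrite subrr.
Qed.

End Retraction.

(** * Linear maps out of tensor products *)

Section TensorLemmas.
Variables (K : fieldType) (U V : lmodType K).

(** Both sides sum over the same chosen representative of [t], so they agree term by term. *)
Lemma eq_tlift (W : lmodType K) (B B' : U -> V -> W) t :
  (forall u v, B u v = B' u v) -> tlift B t = tlift B' t.
Proof. by move=> BE; apply: eq_bigr => p _; exact: BE. Qed.

Lemma linear_tlift (W Z : lmodType K) (L : W -> Z) (B : U -> V -> W) t :
  linear L -> L (tlift B t) = tlift (fun u v => L (B u v)) t.
Proof. exact: linear_map_sum. Qed.

Lemma tlift_sum (W : lmodType K) (I : Type) (r : seq I)
    (B : I -> U -> V -> W) t :
  tlift (fun u v => \sum_(i <- r) B i u v) t = \sum_(i <- r) tlift (B i) t.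
Proof. exact: exchange_big. Qed.

Lemma tliftD (W : lmodType K) (B B' : U -> V -> W) t :
  tlift (fun u v => B u v + B' u v) t = tlift B t + tlift B' t.
Proof. exact: big_split. Qed.

Lemma tensor_ext (W : lmodType K) (F G : tensor U V -> W) :
  linear F -> linear G -> (forall u v, F (u \ox v) = G (u \ox v)) -> F =1 G.
Proof.
move=> lF lG FG t; have [s ->] := tensorP t.
by rewrite !linear_map_sum //; apply: eq_bigr => p _; exact: FG.
Qed.

Lemma tensDl (u u' : U) (v : V) : (u + u') \ox v = u \ox v + u' \ox v.
Proof. exact: (linear_mapD ((@tens_bilinear K U V).1 v) u u'). Qed.
Lemma tensDr (u : U) (v v' : V) : u \ox (v + v') = u \ox v + u \ox v'.
Proof. exact: (linear_mapD ((@tens_bilinear K U V).2 u) v v'). Qed.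
Lemma tensZl a (u : U) (v : V) : (a *: u) \ox v = a *: (u \ox v).
Proof. exact: (linear_mapZ a ((@tens_bilinear K U V).1 v) u). Qed.
Lemma tensZr a (u : U) (v : V) : u \ox (a *: v) = a *: (u \ox v).
Proof. exact: (linear_mapZ a ((@tens_bilinear K U V).2 u) v). Qed.
Lemma tens_sumr (I : Type) (r : seq I) (F : I -> V) (u : U) :
  u \ox (\sum_(i <- r) F i) = \sum_(i <- r) u \ox F i.
Proof. exact: (linear_map_sum _ _ _ ((@tens_bilinear K U V).2 u)). Qed.

Lemma bilinear_comp (U' V' W : lmodType K) (B : U' -> V' -> W)
    (f : U -> U') (g : V -> V') :
  bilinear_map B -> linear f -> linear g ->
  bilinear_map (fun u v => B (f u) (g v)).
Proof.
move=> [Bl Br] lf lg; split=> [v|u] a x y; first by rewrite lf Bl.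
by rewrite lg Br.
Qed.

Lemma bilinear_tmap (U' V' : lmodType K) (f : U -> U') (g : V -> V') :
  linear f -> linear g -> bilinear_map (fun u v => f u \ox g v).
Proof. by move=> lf lg; apply: bilinear_comp => //; exact: tens_bilinear. Qed.

Lemma tmap_tens (U' V' : lmodType K) (f : U -> U') (g : V -> V') u v :
  linear f -> linear g -> tmap f g (u \ox v) = f u \ox g v.
Proof. by move=> lf lg; apply: tlift_tens; exact: bilinear_tmap. Qed.

Lemma tmap_linear (U' V' : lmodType K) (f : U -> U') (g : V -> V') :
  linear f -> linear g -> linear (tmap f g).
Proof. by move=> lf lg; apply: tlift_linear; exact: bilinear_tmap. Qed.

End TensorLemmas.

Section TensorComposition.
Variables (K : fieldType) (U V : lmodType K).

Lemma tlift_tlift (U' V' W : lmodType K) (C : U' -> V' -> W)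
    (B : U -> V -> tensor U' V') t :
  bilinear_map C -> tlift C (tlift B t) = tlift (fun u v => tlift C (B u v)) t.
Proof. by move=> bC; apply: linear_tlift; exact: tlift_linear. Qed.

Lemma tlift_tmap (U' V' W : lmodType K) (C : U' -> V' -> W)
    (f : U -> U') (g : V -> V') t :
  bilinear_map C -> tlift C (tmap f g t) = tlift (fun u v => C (f u) (g v)) t.
Proof.
by move=> bC; rewrite /tmap tlift_tlift //; apply: eq_tlift => u v;
  rewrite tlift_tens.
Qed.

Lemma tlift_id (t : tensor U V) : tlift (@tens K U V) t = t.
Proof.
have ltens := tlift_linear (@tens_bilinear K U V).
apply: (tensor_ext (G := idfun) ltens) => // u v.
exact/tlift_tens/tens_bilinear.
Qed.

Lemma bilinear_tlift (U' V' W : lmodType K) (B : U -> V -> U' -> V' -> W) t :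
  (forall u' v', bilinear_map (fun u v => B u v u' v')) ->
  bilinear_map (fun u v => tlift (B u v) t).
Proof.
move=> bB; split=> [v|u]; apply: linear_sum_fun => p.
  exact: (bB p.1 p.2).1.
exact: (bB p.1 p.2).2.
Qed.

Lemma tmap_cancel (U' V' : lmodType K) (f : U -> U') (g : V -> V')
    (f' : U' -> U) (g' : V' -> V) :
  linear f -> linear g -> linear f' -> linear g' ->
  cancel f f' -> cancel g g' -> cancel (tmap f g) (tmap f' g').
Proof.
move=> lf lg lf' lg' fK gK t.
rewrite [LHS](tlift_tmap f g t (bilinear_tmap lf' lg')).
by rewrite -[RHS]tlift_id; apply: eq_tlift => u v; rewrite fK gK.
Qed.

End TensorComposition.

(** * Bilinearity of products and of scalar weights *)

Section Algebra.
Variables (K : fieldType) (A : algType K).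

Lemma linear_mull (a : A) : linear (fun b => a * b).
Proof. by move=> c u v; rewrite mulrDr scalerAr. Qed.

Lemma linear_mulr (a : A) : linear (fun b => b * a).
Proof. by move=> c u v; rewrite mulrDl scalerAl. Qed.

Lemma bilinear_mul : bilinear_map (@GRing.mul A).
Proof. by split=> [a|a]; [exact: linear_mulr | exact: linear_mull]. Qed.

Lemma bilinear_weight (U : lmodType K) (f : U -> K^o) :
  linear f -> bilinear_map (fun (h : A) (u : U) => (f u : K) *: h).
Proof.
move=> lf; split=> [v|u] a x y.
  by rewrite scalerDr !scalerA mulrC.
by rewrite lf scalerDl scalerA.
Qed.

End Algebra.

Section TensorAlgebra.
Variables (K : fieldType) (A B : algType K).

Lemma bilinear_tens_mul (a : A) (b : B) :
  bilinear_map (fun a' b' => (a * a') \ox (b * b')).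
Proof. by apply: bilinear_tmap; exact: linear_mull. Qed.

Lemma bilinear_tens_mulr (a : A) (b : B) :
  bilinear_map (fun a' b' => (a' * a) \ox (b' * b)).
Proof. by apply: bilinear_tmap; exact: linear_mulr. Qed.

End TensorAlgebra.

(** * Coassociativity in Sweedler form *)

Section HopfLemmas.
Variables (K : fieldType) (H : algType K) (hopf : hopf_algebra H).

(** The element a_(1) \ox a_(2) \ox a_(3) is tested against a trilinear [C]: the linear map that [C]
    induces is applied to both sides of [comulA]. *)
Lemma tlift_comulA (W : lmodType K) (C : H -> H -> H -> W) a :
  (forall w, bilinear_map (fun u v => C u v w)) ->
  (forall u, bilinear_map (C u)) ->
  tlift (fun h k => tlift (fun u v => C u v k) (comul hopf h)) (comul hopf a) =
  tlift (fun h k => tlift (C h) (comul hopf k)) (comul hopf a).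
Proof.
move=> Cw Cu.
have lD := linear_of_linfun (comul hopf).
have bC : bilinear_map (fun u t => tlift (C u) t).
  split=> [t|u]; last exact: tlift_linear.
  by apply: linear_sum_fun => p; exact: (Cw p.2).1.
have bA : bilinear_map
    (fun t (w : H) => tlift (fun u v : H => u \ox (v \ox w)) t).
  split=> [w|t].
    by apply: tlift_linear; apply: bilinear_tmap => //;
      exact: (tens_bilinear _ _).1.
  apply: linear_sum_fun => p c x y.
  by rewrite tensDr tensZr tensDr tensZr.
have := congr1 (tlift (fun u t => tlift (C u) t)) (comulA hopf a).
rewrite /tassoc (tlift_tmap _ _ _ bA) (tlift_tmap _ _ _ bC).
rewrite tlift_tlift // => <-; apply: eq_tlift => h k.
rewrite tlift_tlift //; apply: eq_tlift => u v.
by rewrite !tlift_tens //; exact: tens_bilinear.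
Qed.

End HopfLemmas.

(** * The coaction on X, and its pairing with functionals *)

Section Coaction.
Variables (K : fieldType) (H : algType K) (hopf : hopf_algebra H).
Variables (P : pred H) (X : subAlgType P) (coidX : left_coideal hopf X).

Local Notation Delta := (comul hopf).
Local Notation delta := (coaction coidX).
Local Notation eps := (counit_on hopf (X := X)).

Lemma val_linear : linear (val : X -> H).
Proof. by move=> a u v; rewrite linearP. Qed.

Lemma coactionE a : tmap idfun val (delta a) = Delta (val a).
Proof. by rewrite /coaction; case: cid. Qed.

(** A linear retraction [r] of [val] gives the left inverse id \ox [r]. Identities in H \ox X can
    therefore be checked in H \ox H. *)
Lemma tmap_val_inj : injective (tmap idfun val : tensor H X -> tensor H H).
Proof.
have [r rK] := linear_retraction (i := (val : {linear X -> H})) val_inj.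
by apply: can_inj (tmap_cancel (f' := idfun) (g' := r) _ _ _ _ _ _) => //;
  exact: linear_of_linfun.
Qed.

Lemma coaction_linear : linear delta.
Proof.
have lT : linear (tmap idfun val : tensor H X -> tensor H H).
  by apply: tmap_linear => //; exact: val_linear.
by move=> c u v; apply: tmap_val_inj; rewrite lT !coactionE !linearP.
Qed.

(** Moves a computation from the coaction to the comultiplication of H, where the Hopf axioms are
    available. *)
Lemma tlift_coaction_val (W : lmodType K) (C : H -> H -> W) a :
  bilinear_map C ->
  tlift (fun h x => C h (val x)) (delta a) = tlift C (Delta (val a)).
Proof. by move=> bC; rewrite -coactionE tlift_tmap. Qed.

Lemma coaction_counitr a :
  tlift (fun h x => (eps x : K) *: h) (delta a) = val a.
Proof.
rewrite -[RHS](counitr hopf) -tlift_coaction_val //.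
exact/bilinear_weight/linear_of_linfun.
Qed.

Lemma coaction_counitl a :
  tlift (fun h x => (counit hopf h : K) *: x) (delta a) = a.
Proof.
apply: val_inj; rewrite (linear_tlift _ _ val_linear) /=.
rewrite -[RHS](counitl hopf) -tlift_coaction_val.
  by apply: eq_tlift => h x; rewrite linearZ.
split=> [v|u] c x y; first by rewrite linearP scalerDl scalerA.
by rewrite scalerDr !scalerA mulrC.
Qed.

Lemma coaction1 : delta 1 = 1 \ox 1.
Proof.
apply: tmap_val_inj; rewrite coactionE tmap_tens //; last exact: val_linear.
by rewrite rmorph1 comul1.
Qed.

Lemma coactionM a b : delta (a * b) = tmul (delta a) (delta b).
Proof.
have bI : bilinear_map (fun (h : H) (x : X) => idfun h \ox val x).
  by apply: bilinear_tmap => //; exact: val_linear.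
apply: tmap_val_inj; rewrite coactionE rmorphM comulM -!coactionE.
rewrite /tmul tlift_tmap; last first.
  by apply: bilinear_tlift => u v; exact: bilinear_tens_mulr.
rewrite [RHS]tlift_tlift //; apply: eq_tlift => h x.
rewrite tlift_tmap; last exact: bilinear_tens_mul.
rewrite tlift_tlift //; apply: eq_tlift => h' y.
by rewrite tlift_tens //= (rmorphM (val : {rmorphism X -> H})).
Qed.

Lemma tlift_coactionM (W : lmodType K) (C : H -> X -> W) a b :
  bilinear_map C ->
  tlift C (delta (a * b)) =
  tlift (fun h x => tlift (fun h' y => C (h * h') (x * y)) (delta b)) (delta a).
Proof.
move=> bC; rewrite coactionM tlift_tlift //; apply: eq_tlift => h x.
by rewrite tlift_tlift //; apply: eq_tlift => h' y; rewrite tlift_tens.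
Qed.

(** Since [C] takes its last argument in X only, it is extended to H by a linear retraction of
    [val]. Coassociativity in H applies to the extension, and the retraction cancels on elements of
    X. *)
Lemma tlift_coactionA (W : lmodType K) (C : H -> H -> X -> W) a :
  (forall x, bilinear_map (fun u v => C u v x)) ->
  (forall u, bilinear_map (C u)) ->
  tlift (fun h x => tlift (fun u v => C u v x) (Delta h)) (delta a) =
  tlift (fun h x => tlift (C h) (delta x)) (delta a).
Proof.
move=> Cx Cu.
have lD := linear_of_linfun Delta.
have [r rK] := linear_retraction (i := (val : {linear X -> H})) val_inj.
pose C' u v k := C u v (r k).
have C'k k : bilinear_map (fun u v => C' u v k) by exact: Cx.
have C'u u : bilinear_map (C' u).
  by apply: (bilinear_comp (f := idfun) (Cu u)) => //; exact: linear_of_linfun.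
have bl : bilinear_map (fun h k => tlift (fun u v => C' u v k) (Delta h)).
  split=> [k c x y|h]; first by rewrite linearP tlift_linear.
  by apply: linear_sum_fun => p; exact: (C'u p.1).2.
have br : bilinear_map (fun h k => tlift (C' h) (Delta k)).
  split=> [k|h c x y]; last by rewrite linearP tlift_linear.
  by apply: linear_sum_fun => p; exact: (C'k p.2).1.
transitivity (tlift (fun h k => tlift (fun u v => C' u v k) (Delta h))
    (Delta (val a))).
  rewrite -tlift_coaction_val //; apply: eq_tlift => h x.
  by apply: eq_tlift => u v; rewrite /C' rK.
rewrite tlift_comulA // -tlift_coaction_val //; apply: eq_tlift => h x.
rewrite -tlift_coaction_val //; apply: eq_tlift => u v.
by rewrite /C' rK.
Qed.

(** This is a_(1) f(a_(2)), the right side of (1) when f = chi_k. *)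
Definition convolve (f : X -> K^o) (a : X) : H :=
  tlift (fun h x => (f x : K) *: h) (delta a).

Lemma convolve_linear f : linear f -> linear (convolve f).
Proof.
by move=> lf c u v; rewrite /convolve coaction_linear tlift_linear //;
  exact: bilinear_weight.
Qed.

Lemma convolve_eps a : convolve eps a = val a.
Proof. exact: coaction_counitr. Qed.

(** By linearity eps(a_(1)) f(a_(2)) = f(eps(a_(1)) a_(2)), so [f] can be recovered from
    [convolve f]. *)
Lemma counit_convolve f a : linear f -> counit hopf (convolve f a) = f a.
Proof.
move=> lf; rewrite /convolve (linear_tlift _ _ (linear_of_linfun _)).
rewrite -[in RHS](coaction_counitl a) (linear_tlift _ _ lf).
apply: eq_tlift => h x; rewrite linearZ /= (linear_mapZ _ lf).
by rewrite /GRing.scale /= mulrC.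
Qed.

Lemma convolveM (f g : X -> K^o) a b :
  convolve f a * convolve g b =
  tlift (fun h x => tlift (fun h' y => (f x * g y : K) *: (h * h')) (delta b))
    (delta a).
Proof.
rewrite [LHS](linear_tlift _ _ (linear_mulr _)); apply: eq_tlift => h x.
rewrite [LHS](linear_tlift _ _ (linear_mull _)); apply: eq_tlift => h' y.
by rewrite -scalerAl -scalerAr scalerA.
Qed.

(** Multiplicativity of the coaction carries a decomposition of f(xy) over to [convolve]. The
    separate pair [g0], [k0] is meant for the term eps(x) chi_j(y) of the coproduct of chi_j. *)
Lemma convolve_mul (f : X -> K^o) n (g k : 'I_n -> X -> K^o)
    (g0 k0 : X -> K^o) a b :
  linear f ->
  (forall x y, f (x * y) = (\sum_i g i x * k i y) + g0 x * k0 y) ->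
  convolve f (a * b) =
  (\sum_i convolve (g i) a * convolve (k i) b) + convolve g0 a * convolve k0 b.
Proof.
move=> lf fM; rewrite {1}/convolve tlift_coactionM; last exact: bilinear_weight.
under eq_bigr do rewrite convolveM.
rewrite convolveM -tlift_sum -tliftD; apply: eq_tlift => h x.
rewrite -tlift_sum -tliftD; apply: eq_tlift => h' y.
by rewrite fM scalerDl scaler_suml.
Qed.

(** By coassociativity both sides are a_(1) \ox a_(2) f(a_(3)). *)
Lemma comul_convolve f a : linear f ->
  Delta (convolve f a) = tlift (fun h x => h \ox convolve f x) (delta a).
Proof.
move=> lf; rewrite (linear_tlift _ _ (linear_of_linfun Delta)).
have bC u : bilinear_map (fun v x => (f x : K) *: (u \ox v : tensor H H)).
  split=> [x|v] c y z.
    by rewrite tensDr tensZr scalerDr !scalerA mulrC.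
  by rewrite lf scalerDl scalerA.
transitivity (tlift (fun h x =>
    tlift (fun u v => (f x : K) *: (u \ox v)) (Delta h)) (delta a)).
  apply: eq_tlift => h x; rewrite linearZ /= -[in LHS](tlift_id (Delta h)).
  by rewrite scaler_sumr.
rewrite (tlift_coactionA (C := fun u v x => (f x : K) *: (u \ox v))) //.
  apply: eq_tlift => h x.
  rewrite [RHS](linear_tlift _ _ ((tens_bilinear _ _).2 h)).
  by apply: eq_tlift => u v; rewrite tensZr.
move=> x; split=> [v|u] c y z.
  by rewrite tensDl tensZl scalerDr !scalerA mulrC.
by rewrite tensDr tensZr scalerDr !scalerA mulrC.
Qed.

End Coaction.

(** * The matrix pi, and the d_i built from a family chi dual to e *)

Section Coordinates.
Variables (K : fieldType) (H : algType K) (hopf : hopf_algebra H).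
Variables (P : pred H) (X : subAlgType P) (coidX : left_coideal hopf X).
Variables (M : nat) (e : 'I_M -> X) (pi : 'I_M -> 'I_M -> H).
Hypothesis piE : forall i, coaction coidX (e i) = \sum_j pi i j \ox e j.
Variable chi : 'I_M -> X -> K^o.
Hypothesis chi_linear : forall i, linear (chi i).
Hypothesis chi_e : forall i j, chi i (e j) = (i == j)%:R.

Local Notation Delta := (comul hopf).
Local Notation S := (antipode hopf).
Local Notation eps := (counit_on hopf (X := X)).
Local Notation del := (partial_of coidX pi chi).

Lemma sum_chi_e (W : lmodType K) k (F : 'I_M -> W) :
  \sum_j (chi k (e j) : K) *: F j = F k.
Proof.
rewrite (bigD1 k) //= chi_e eqxx scale1r big1 ?addr0 // => j jk.
by rewrite chi_e eq_sym (negPf jk) scale0r.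
Qed.

Lemma tlift_coaction_e (W : lmodType K) (C : H -> X -> W) i :
  bilinear_map C -> tlift C (coaction coidX (e i)) = \sum_j C (pi i j) (e j).
Proof.
move=> bC; rewrite piE (linear_map_sum _ _ _ (tlift_linear bC)).
by apply: eq_bigr => j _; rewrite tlift_tens.
Qed.

(** Duality extracts one entry from the coaction of e^i. With pi written in this way, its coproduct
    and counit follow from the rules for [convolve]. *)
Lemma convolve_e k i : convolve coidX (chi k) (e i) = pi i k.
Proof.
rewrite /convolve tlift_coaction_e ?sum_chi_e //.
exact: bilinear_weight.
Qed.

Lemma comul_pi i k : Delta (pi i k) = \sum_j pi i j \ox pi j k.
Proof.
rewrite -convolve_e comul_convolve // tlift_coaction_e; last first.
  by apply: bilinear_tmap => //; exact: convolve_linear.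
by apply: eq_bigr => j _; rewrite convolve_e.
Qed.

Lemma counit_pi i k : counit hopf (pi i k) = (i == k)%:R.
Proof. by rewrite -convolve_e counit_convolve // chi_e eq_sym. Qed.

Lemma tlift_comul_pi (W : lmodType K) (C : H -> H -> W) i k :
  bilinear_map C -> tlift C (Delta (pi i k)) = \sum_j C (pi i j) (pi j k).
Proof.
move=> bC; rewrite comul_pi (linear_map_sum _ _ _ (tlift_linear bC)).
by apply: eq_bigr => j _; rewrite tlift_tens.
Qed.

(** The antipode axiom at [pi i k], whose coproduct has the form of a matrix product. *)
Lemma pi_antipode i k : \sum_j pi i j * S (pi j k) = (i == k)%:R.
Proof.
rewrite -(@tlift_comul_pi _ (fun x y => x * S y)).
  by rewrite antipoder counit_pi scaler_nat.
by apply: (bilinear_comp (f := idfun) (@bilinear_mul _ H)) => //;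
  exact: linear_of_linfun.
Qed.

Lemma antipode_pi i k : \sum_j S (pi i j) * pi j k = (i == k)%:R.
Proof.
rewrite -(@tlift_comul_pi _ (fun x y => S x * y)).
  by rewrite antipodel counit_pi scaler_nat.
by apply: (bilinear_comp (g := idfun) (@bilinear_mul _ H)) => //;
  exact: linear_of_linfun.
Qed.

Lemma partial_ofE i a :
  del i a = \sum_j convolve coidX (chi j) a * S (pi j i).
Proof.
apply: eq_bigr => j _; rewrite [RHS](linear_tlift _ _ (linear_mulr _)).
by apply: eq_tlift => h x; rewrite scalerAl.
Qed.

Lemma sum_delta (W : pzRingType) k (F : 'I_M -> W) :
  \sum_i F i * (i == k)%:R = F k.
Proof.
rewrite (bigD1 k) //= eqxx mulr1 big1 ?addr0 // => j /negPf->.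
by rewrite mulr0.
Qed.

Lemma partial_of_pi k a : \sum_i del i a * pi i k = convolve coidX (chi k) a.
Proof.
rewrite -[RHS](sum_delta k (fun j => convolve coidX (chi j) a)).
under eq_bigr do rewrite partial_ofE mulr_suml.
rewrite exchange_big; apply: eq_bigr => j _ /=; rewrite -antipode_pi mulr_sumr.
by apply: eq_bigr => i _; rewrite mulrA.
Qed.

(* The matrix pi is invertible, with inverse S pi. *)
Lemma partial_of_unique a (d : 'I_M -> H) :
  (forall k, \sum_i d i * pi i k = convolve coidX (chi k) a) ->
  forall i, d i = del i a.
Proof.
move=> dE i; rewrite -(sum_delta i d) partial_ofE.
under [RHS]eq_bigr do rewrite -dE mulr_suml.
rewrite exchange_big; apply: eq_bigr => j _ /=; rewrite -pi_antipode mulr_sumr.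
by apply: eq_bigr => k _; rewrite mulrA.
Qed.

Lemma partial_of_linear i : linear (del i).
Proof.
move=> c u v; rewrite !partial_ofE scaler_sumr -big_split /=.
apply: eq_bigr => j _.
by rewrite convolve_linear // mulrDl scalerAl.
Qed.

Lemma counitM a b : counit hopf (a * b) = (counit hopf a : K) * counit hopf b.
Proof. exact: rmorphM. Qed.

(** The counit is applied to (1); it is multiplicative and turns pi into the identity matrix. *)
Lemma counit_partial_of i a : counit hopf (del i a) = chi i a.
Proof.
have /(congr1 (counit hopf)) := partial_of_pi i a.
rewrite counit_convolve // linear_sum /= => <-.
rewrite -(sum_delta i (fun j => (counit hopf (del j a) : K))).
by apply: eq_bigr => j _; rewrite counitM counit_pi.
Qed.

(** The constants on the right solve (1) at a = e^k, and the solution is unique. *)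
Lemma partial_of_e i k : del i (e k) = (k == i)%:R.
Proof.
symmetry; apply: (partial_of_unique (d := fun i => (k == i)%:R)) => j.
rewrite convolve_e (bigD1 k) //= eqxx mul1r big1 ?addr0 // => l.
by rewrite eq_sym => /negPf->; rewrite mul0r.
Qed.

Lemma partial_of1 i : (forall j, chi j 1 = 0) -> del i 1 = 0.
Proof.
move=> chi1; rewrite partial_ofE big1 // => j _.
rewrite /convolve coaction1 tlift_tens; last exact: bilinear_weight.
by rewrite chi1 scale0r mul0r.
Qed.

(** The Leibniz rule (2) in H. The coproduct of the chi_j first gives such a rule with unknown
    coefficients, which are then found by evaluation at e^i. *)
Lemma partial_ofM (f : 'I_M -> 'I_M -> X -> K^o) :
  (forall j x y, chi j (x * y) = \sum_i chi i x * f i j y + eps x * chi j y) ->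
  forall j a b, del j (a * b) =
    \sum_i del i a * (del j (e i * b) - val (e i) * del j b) + val a * del j b.
Proof.
move=> chiM j a b.
(* The factors pi come from rewriting [convolve] of chi_k at a by (1), the factors S(pi) from the
   definition of d_j. *)
pose T i b := \sum_l \sum_k pi i k * convolve coidX (f k l) b * S (pi l j).
have dM a' : del j (a' * b) =
    \sum_i del i a' * T i b + val a' * del j b.
  rewrite partial_ofE.
  under eq_bigr => l _.
    rewrite (convolve_mul coidX _ _ (chi_linear l) (chiM l)) mulrDl mulr_suml.
    over.
  rewrite big_split /=; congr (_ + _); last first.
    rewrite partial_ofE mulr_sumr; apply: eq_bigr => l _.
    by rewrite convolve_eps mulrA.
  under [RHS]eq_bigr do rewrite mulr_sumr.
  rewrite [RHS]exchange_big; apply: eq_bigr => l _ /=.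
  under [RHS]eq_bigr do rewrite mulr_sumr.
  rewrite [RHS]exchange_big; apply: eq_bigr => k _ /=.
  by rewrite -partial_of_pi !mulr_suml; apply: eq_bigr => i _; rewrite !mulrA.
(* At a' = e^i the sum in [dM] reduces to [T i b], because d_k(e^i) is 1 for k = i and 0
   otherwise. *)
rewrite dM; congr (_ + _); apply: eq_bigr => i _; congr (_ * _).
rewrite dM addrK -[LHS]mul1r (bigD1 i) //= partial_of_e eqxx big1 ?addr0 //.
by move=> k ki; rewrite partial_of_e eq_sym (negPf ki) mul0r.
Qed.

Variable dX : 'I_M -> X -> X.
Hypothesis dXE : forall i a, val (dX i a) = del i a.

(** The comultiplication is applied to (1) for each k, the second leg is multiplied by S(pi^k_m),
    and the results are summed over k. On one side pi cancels against S(pi) and pi^i_m remains in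
    the first leg; on the other side d_m is reassembled in the second leg. *)
Lemma coaction_partial m b :
  \sum_i tlift (fun h y => (h * pi i m) \ox y) (coaction coidX (dX i b)) =
  tlift (fun h y => h \ox dX m y) (coaction coidX b).
Proof.
have lval := @val_linear _ _ _ X.
have lT : linear (tmap idfun val : tensor H X -> tensor H H).
  exact: tmap_linear.
apply: tmap_val_inj; rewrite (linear_map_sum _ _ _ lT).
transitivity (\sum_i
    tlift (fun u v => (u * pi i m) \ox v) (Delta (del i b))).
  apply: eq_bigr => i _; rewrite (linear_tlift _ _ lT) -dXE.
  rewrite -tlift_coaction_val.
    by apply: eq_tlift => h x; rewrite tmap_tens.
  by apply: (bilinear_tmap (g := idfun)) => //; exact: linear_mulr.
rewrite (linear_tlift _ _ lT).
transitivity (tlift (fun h y => h \ox del m y) (coaction coidX b)); last first.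
  by apply: eq_tlift => h y; rewrite tmap_tens // dXE.
(* [R k] multiplies the second leg on the right by S(pi^k_m). *)
pose R k := tmap idfun (fun v : H => v * S (pi k m)) : tensor H H -> tensor H H.
have bR k : bilinear_map (fun u v : H => idfun u \ox (v * S (pi k m))).
  by apply: bilinear_tmap => //; exact: linear_mulr.
have lR k : linear (R k) by exact: tlift_linear.
have RE k u v : R k (u \ox v) = u \ox (v * S (pi k m)) by exact: tlift_tens.
transitivity (\sum_k R k (Delta (convolve coidX (chi k) b))); last first.
  under eq_bigr do rewrite comul_convolve // (linear_tlift _ _ (lR _)).
  rewrite -tlift_sum; apply: eq_tlift => h y.
  under eq_bigr do rewrite RE.
  by rewrite -tens_sumr partial_ofE.
under [RHS]eq_bigr => k _.
  rewrite -partial_of_pi linear_sum (linear_map_sum _ _ _ (lR k)) /=.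
  over.
rewrite exchange_big; apply: eq_bigr => i _ /=.
under [RHS]eq_bigr => k _.
  rewrite comulM (linear_tlift _ _ (lR k)).
  under eq_tlift => u v.
    rewrite tlift_comul_pi; last exact: bilinear_tens_mul.
    rewrite (linear_map_sum _ _ _ (lR k)).
    under eq_bigr do rewrite RE -mulrA.
    over.
  over.
rewrite -tlift_sum; apply: eq_tlift => u v.
rewrite exchange_big /= (bigD1 m) //=.
rewrite -tens_sumr -mulr_sumr pi_antipode eqxx mulr1 big1 ?addr0 //.
move=> l lm; rewrite -tens_sumr -mulr_sumr pi_antipode (negPf lm) mulr0.
exact: (linear_map0 ((tens_bilinear _ _).2 _)).
Qed.

End Coordinates.

(** * The restricted dual and the counit on X *)

Section Restricted.
Variables (K : fieldType) (A : algType K).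

Lemma subspace_restricted : subspace (@restricted K A).
Proof.
have [r0 rD] := @restricted_closed K A; split; first exact/asboolP.
by move=> c f g rf rg; apply/asboolP/rD; exact/asboolP.
Qed.

Lemma restricted_mull (f : A -> K^o) c :
  restricted f -> restricted (fun b => f (c * b)).
Proof.
move=> [lf [n [g [h [lg lh fE]]]]]; split.
  by move=> a u v; rewrite linear_mull lf.
exists n, (fun k a => g k (c * a)), h; split=> // [k a u v|a b].
  by rewrite linear_mull lg.
by rewrite mulrA fE.
Qed.

(** A sigma type, so that whole families of functionals can be lifted with [sval]. *)
Lemma rdual_of (f : A -> K^o) : 
  restricted f -> {g : rdual A | g = f :> (A -> K^o)}.
Proof.
move=> rf; have pf : restricted_pred f by exact/asboolP.
by exists (RDual pf); reflexivity.
Qed.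

Lemma rdual_linearE c (f g : rdual A) a : (c *: f + g) a = c *: f a + g a.
Proof. by []. Qed.

Lemma bilinear_rdual a b :
  bilinear_map (fun g h : rdual A => (g a : K) *: h b : K^o).
Proof.
split=> [h|g] c x y.
  by rewrite rdual_linearE scalerDl scalerA.
by rewrite rdual_linearE scalerDr !scalerA mulrC.
Qed.

End Restricted.

Section CounitOn.
Variables (K : fieldType) (H : algType K) (hopf : hopf_algebra H).
Variables (P : pred H) (X : subAlgType P).
Local Notation eps := (counit_on hopf (X := X)).

Lemma counit_on_linear : linear eps.
Proof. by move=> c u v; rewrite /counit_on !linearP. Qed.

Lemma counit_onM x y : eps (x * y) = eps x * eps y.
Proof. by rewrite /counit_on (rmorphM (val : {rmorphism X -> H})) counitM. Qed.

Lemma counit_on1 : eps 1 = 1.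
Proof. by rewrite /counit_on !rmorph1. Qed.

Lemma restricted_counit_on : restricted eps.
Proof.
split; first exact: counit_on_linear.
exists 1%N, (fun _ => eps), (fun _ => eps).
by split=> [_|_|a b]; rewrite ?big_ord1 ?counit_onM //; exact: counit_on_linear.
Qed.

End CounitOn.

(** * Bimodules and first order calculi *)

Section Bimodule.
Variables (K : fieldType) (A : algType K) (G : bimodule A).

Lemma lact_linear a : linear (lact a : G -> G).
Proof. exact: (lact_bilinear G).2. Qed.

Lemma lact_linearl w : linear ((@lact K A G)^~ w).
Proof. exact: (lact_bilinear G).1. Qed.

Lemma ract_linear b : linear (ract^~ b : G -> G).
Proof. exact: (ract_bilinear G).1. Qed.

End Bimodule.

Lemma fodc_diff1 (K : fieldType) (A : algType K) (G : fodc A) : diff G 1 = 0.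
Proof.
apply: (@addrI _ (diff G 1)); rewrite addr0 -[in RHS](mulr1 1) diffM.
by rewrite ract1 lact1.
Qed.

(** The Leibniz rule solved for the right action, which is thereby determined by d and the left
    action. *)
Lemma fodc_ractE (K : fieldType) (A : algType K) (G : fodc A) a b :
  ract (diff G a) b = diff G (a * b) - lact a (diff G b).
Proof. by rewrite diffM addrK. Qed.

(** * Coefficients with respect to the de^i under (F) *)

Section FreeCalculus.
Variables (K : fieldType) (H : algType K) (P : pred H) (X : subAlgType P).
Variables (M : nat) (e : 'I_M -> X) (G : fodc X) (GF : condF e G).

Local Notation de i := (diff G (e i)).
Local Notation del := (partial GF).

Lemma partialE a : diff G a = \sum_i lact (del i a) (de i).
Proof. by rewrite /partial; case: cid => c []. Qed.

(** Uniqueness in (F) concerns elements of the form da only, but 0 = d0 is one of them. *)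
Lemma diff_basis_free (c : 'I_M -> X) :
  \sum_i lact (c i) (de i) = 0 -> forall i, c i = 0.
Proof.
move=> c0 i; have [c1 [_ uniq]] := GF 0.
have E0 : c1 = [ffun=> 0].
  apply: uniq; rewrite linear0 big1 // => j _; rewrite ffunE.
  exact: (linear_map0 (lact_linearl _)).
have : c1 = [ffun j => c j].
  apply: uniq; rewrite linear0 -[LHS]c0; apply: eq_bigr => j _.
  by rewrite ffunE.
by rewrite E0 => /ffunP/(_ i); rewrite !ffunE.
Qed.

Lemma lact_sumB (c c' : 'I_M -> X) :
  \sum_i lact (c i - c' i) (de i) =
  \sum_i lact (c i) (de i) - \sum_i lact (c' i) (de i).
Proof.
rewrite -sumrB; apply: eq_bigr => i _.
have [g gE] := linear_pack (lact_linearl (de i)).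
by rewrite -!gE linearB.
Qed.

Lemma diff_basis_inj (c c' : 'I_M -> X) :
  \sum_i lact (c i) (de i) = \sum_i lact (c' i) (de i) ->
  forall i, c i = c' i.
Proof.
move=> E i; apply/eqP; rewrite -subr_eq0; apply/eqP.
apply: (@diff_basis_free (fun i => c i - c' i)).
by rewrite lact_sumB E subrr.
Qed.

(** Condition (F) expands each db, and the left multiples a db span Gamma. *)
Lemma coeff_exists (w : G) : exists c : 'I_M -> X, w = \sum_i lact (c i) (de i).
Proof.
pose T := [set w : G | exists c : 'I_M -> X, w = \sum_i lact (c i) (de i)].
apply: (Lin_min (T := T) _ _ (fodc_span w)) => [|_ [a [b ->]]].
  split=> [|a _ _ [c ->] [c' ->]].
    exists (fun _ => 0); rewrite big1 // => i _.
    exact: (linear_map0 (lact_linearl _)).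
  exists (fun i => a *: c i + c' i); rewrite scaler_sumr -big_split /=.
  by apply: eq_bigr => i _; rewrite (lact_linearl (de i)).
exists (fun i => a * del i b); rewrite partialE.
rewrite (linear_map_sum _ _ _ (lact_linear a)).
by apply: eq_bigr => i _; rewrite lactM.
Qed.

Definition coeff (w : G) : 'I_M -> X := sval (cid (coeff_exists w)).

Lemma coeffE w : w = \sum_i lact (coeff w i) (de i).
Proof. by rewrite /coeff; case: cid. Qed.

Lemma coeffP w (c : 'I_M -> X) :
  w = \sum_i lact (c i) (de i) -> forall i, coeff w i = c i.
Proof. by move=> wE; apply: diff_basis_inj; rewrite -coeffE. Qed.

Lemma coeff_linear i : linear (coeff^~ i).
Proof.
move=> a u v; apply: (coeffP (c := fun i => a *: coeff u i + coeff v i)).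
rewrite {1}(coeffE u) {1}(coeffE v) scaler_sumr -big_split /=.
by apply: eq_bigr => j _; rewrite (lact_linearl (de j)).
Qed.

Lemma coeff_lact a w i : coeff (lact a w) i = a * coeff w i.
Proof.
apply: (coeffP (c := fun i => a * coeff w i)); rewrite {1}(coeffE w).
rewrite (linear_map_sum _ _ _ (lact_linear a)).
by apply: eq_bigr => j _; rewrite lactM.
Qed.

Lemma coeff_diff a i : coeff (diff G a) i = del i a.
Proof. exact/coeffP/partialE. Qed.

Lemma partial_linear i : linear (del i).
Proof.
by move=> a u v; rewrite -!coeff_diff linearP coeff_linear.
Qed.

Lemma partial_e i j : del i (e j) = (i == j)%:R.
Proof.
rewrite -coeff_diff; apply: (coeffP (c := fun i => (i == j)%:R)).
rewrite (bigD1 j) //= eqxx lact1 big1 ?addr0 // => k /negPf->.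
exact: (linear_map0 (lact_linearl _)).
Qed.

Lemma partial1 i : del i 1 = 0.
Proof. by rewrite -coeff_diff fodc_diff1 (linear_map0 (coeff_linear i)). Qed.

(** This is (2): by [fodc_ractE] the product de^i b equals d(e^i b) - e^i db, and t^i_j(b) is its
    j-th coefficient. *)
Lemma partialM j a b :
  del j (a * b) =
  \sum_i del i a * (del j (e i * b) - e i * del j b) + a * del j b.
Proof.
rewrite -coeff_diff diffM (linear_mapD (coeff_linear j)) coeff_lact coeff_diff.
congr (_ + _).
rewrite partialE (linear_map_sum _ _ _ (ract_linear b)).
rewrite (linear_map_sum _ _ _ (coeff_linear j)); apply: eq_bigr => i _.
rewrite lractA coeff_lact fodc_ractE; congr (_ * _).
have [g gE] := linear_pack (coeff_linear j).
by rewrite -gE linearB /= !gE coeff_lact !coeff_diff.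
Qed.

End FreeCalculus.

(** * From a covariant calculus to an admissible set of functionals *)

Section CovariantCalculus.
Variables (K : fieldType) (H : algType K) (hopf : hopf_algebra H).
Variables (P : pred H) (X : subAlgType P) (coidX : left_coideal hopf X).
Variables (M : nat) (e : 'I_M -> X) (pi : 'I_M -> 'I_M -> H).
Hypothesis piE : forall i, coaction coidX (e i) = \sum_j pi i j \ox e j.
Variables (G : fodc X) (GF : condF e G).

Local Notation eps := (counit_on hopf (X := X)).
Local Notation chi := (fun i => eps \o partial GF i).

Lemma functional_linear i : linear (chi i).
Proof. by move=> c u v; rewrite /= partial_linear counit_on_linear. Qed.

Lemma functional_e i j : chi i (e j) = (i == j)%:R.
Proof.
rewrite /= partial_e; case: eqP => _; first exact: counit_on1.
rewrite !mulr0n.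
exact: (linear_map0 (counit_on_linear hopf (X := X))).
Qed.

Lemma functional1 i : chi i 1 = 0.
Proof.
by rewrite /= partial1 (linear_map0 (counit_on_linear hopf (X := X))).
Qed.

(** The functional eps o t^i_j, with t^i_j from (2). *)
Definition twist i j (b : X) : K^o := chi j (e i * b) - eps (e i) * chi j b.

Lemma functionalM j a b :
  chi j (a * b) = \sum_i chi i a * twist i j b + eps a * chi j b.
Proof.
have leps := counit_on_linear hopf (X := X).
rewrite /= partialM (linear_mapD leps) counit_onM; congr (_ + _).
rewrite (linear_map_sum _ _ _ leps); apply: eq_bigr => i _.
rewrite counit_onM; congr (_ * _); rewrite /twist /=.
have [g gE] := linear_pack leps.
by rewrite -!gE linearB /= !gE counit_onM.
Qed.

Lemma restricted_functional i : restricted (chi i).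
Proof.
split; first exact: functional_linear.
(* Index 0 carries eps \ox chi_i, and the other M indices carry chi_j \ox [twist j i]. *)
exists M.+1, (fun k => if unlift ord0 k is Some j then chi j else eps).
exists (fun k => if unlift ord0 k is Some j then twist j i else chi i).
split=> [k|k|a b].
- case: (unlift _ _) => [j|]; first exact: functional_linear.
  exact: counit_on_linear.
- case: (unlift _ _) => [j|]; last exact: functional_linear.
  move=> c u v; rewrite /twist linear_mull !(functional_linear i).
  rewrite mulrDr opprD addrACA scalerBr; congr (_ - _ + _).
  by rewrite /GRing.scale /= mulrCA.
rewrite big_ord_recl unlift_none [LHS]functionalM addrC; congr (_ + _).
by apply: eq_bigr => j _; rewrite liftK.
Qed.

Lemma restricted_twist i j : restricted (twist i j).
Proof.
have [_ rD] := @subspace_restricted K X.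
have -> : twist i j = (- eps (e i) : K) *: chi j + (fun b => chi j (e i * b)).
  by apply/funext => b; rewrite /twist addrC -mulNr.
apply: rD; first exact: restricted_functional.
exact/restricted_mull/restricted_functional.
Qed.

(** The functionals with a coproduct whose left legs lie in [W] form the subspace [T], so only eps
    and the chi_j need checking. The first is multiplicative, hence group-like; for the others
    [functionalM] displays the coproduct. *)
Lemma right_coideal_functionals : right_coideal (Lin (eps |` range chi)).
Proof.
pose W := Lin (eps |` range chi).
have sW : subspace W by exact: subspace_Lin.
split=> //.
  apply: (Lin_min (@subspace_restricted K X)) => _ [->|[i _ <-]].
    exact: restricted_counit_on.
  exact: restricted_functional.
pose S := [set s : tensor (rdual X) (rdual X) |
  exists w g : rdual X, W w /\ s = w \ox g].
pose T := [set f : X -> K^o | exists t : tensor (rdual X) (rdual X),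
  (forall a b,
     tlift (fun g h : rdual X => (g a : K) *: h b : K^o) t = f (a * b)) /\
  Lin S t].
have lift_lin a b := tlift_linear (@bilinear_rdual K X a b).
have sS : subspace (Lin S) by exact: subspace_Lin.
have sT : subspace T.
  split=> [|c f f' [t [tE St]] [t' [tE' St']]].
    exists 0; split=> [a b|]; last exact: sS.1.
    by rewrite (linear_map0 (lift_lin a b)).
  exists (c *: t + t'); split=> [a b|]; last exact: sS.2.
  by rewrite lift_lin tE tE'.
have Weps : W eps by apply: Lin_subset; left.
have Wchi i : W (chi i) by apply: Lin_subset; right; exists i.
have [reps repsE] := rdual_of (restricted_counit_on hopf X).
pose rchi i := sval (rdual_of (restricted_functional i)).
have rchiE i : rchi i = chi i :> (X -> K^o) by rewrite /rchi; case: rdual_of.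
pose rtw i j := sval (rdual_of (restricted_twist i j)).
have rtwE i j : rtw i j = twist i j :> (X -> K^o).
  by rewrite /rtw; case: rdual_of.
move=> f Wf; apply: (Lin_min sT _ Wf) => _ [->|[j _ <-]].
  exists (reps \ox reps); split=> [a b|].
    by rewrite tlift_tens ?repsE ?counit_onM //; exact: bilinear_rdual.
  by apply: Lin_subset; exists reps, reps; rewrite repsE.
exists (\sum_i rchi i \ox rtw i j + reps \ox rchi j); split=> [a b|].
  rewrite functionalM (linear_mapD (lift_lin a b)).
  rewrite (linear_map_sum _ _ _ (lift_lin a b)).
  rewrite tlift_tens; last exact: bilinear_rdual.
  rewrite repsE rchiE; congr (_ + _); apply: eq_bigr => i _.
  by rewrite tlift_tens ?rtwE ?rchiE //; exact: bilinear_rdual.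
rewrite -[X in X + _]scale1r; apply: sS.2; last first.
  by apply: Lin_subset; exists reps, (rchi j); rewrite repsE.
under eq_bigr do rewrite -[_ \ox _]scale1r.
apply: subspace_sum => // i.
by apply: Lin_subset; exists (rchi i), (rtw i j); rewrite rchiE.
Qed.

Hypothesis covG : covariant coidX G.

(** Covariance yields (1) for the coefficients of da, and inverting pi determines them from chi. *)
Lemma partial_covariant i a :
  val (partial GF i a) = partial_of coidX pi chi i a.
Proof.
pose d i := val (partial GF i a).
apply: (partial_of_unique piE functional_linear functional_e (d := d)) => k {i}.
have [D DE] := covG.
have bE : bilinear_map
    (fun (h : H) (w : G) => (eps (coeff GF w k) : K) *: h).
  apply: bilinear_weight => c u v.
  by rewrite coeff_linear counit_on_linear.
(* [E] is id \ox (eps o k-th coefficient). *)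
pose E := tlift (fun (h : H) (w : G) => (eps (coeff GF w k) : K) *: h).
have lED : linear (E \o D).
  by move=> c u v; rewrite /= linearP; exact: tlift_linear.
have bC (h : H) (x : X) : bilinear_map
    (fun h' y => (eps (x * partial GF k y) : K) *: (h * h')).
  split=> [y|h'] c u v.
    by rewrite /= linear_mull scalerDr !scalerA mulrC.
  by rewrite /= partial_linear linear_mull counit_on_linear scalerDl scalerA.
have ED x b : E (D (lact x (diff G b))) =
    tlift (fun h x => tlift (fun h' y =>
      (eps (x * partial GF k y) : K) *: (h * h')) (coaction coidX b))
    (coaction coidX x).
  rewrite DE /E tlift_tlift //; apply: eq_tlift => h y.
  rewrite tlift_tlift //; apply: eq_tlift => h' z.
  by rewrite tlift_tens // coeff_lact coeff_diff.
(* Expanding da in the de^i gives the left side of (1); writing da as 1 da gives the right side. *)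
transitivity (E (D (diff G a))).
  rewrite (partialE GF) [RHS](linear_map_sum _ _ _ lED).
  apply: eq_bigr => i _ /=.
  rewrite ED -[d i](convolve_eps coidX) /convolve.
  rewrite [LHS](linear_tlift _ _ (linear_mulr _)); apply: eq_tlift => h x.
  rewrite (tlift_coaction_e piE) // (bigD1 k) //= partial_e eqxx mulr1.
  rewrite -scalerAl big1 ?addr0 // => j; rewrite partial_e eq_sym => /negPf->.
  by rewrite mulr0 (linear_map0 (counit_on_linear hopf (X := X))) scale0r.
rewrite -[diff G a]lact1 ED coaction1 tlift_tens.
  by apply: eq_tlift => h x; rewrite !mul1r.
apply: bilinear_tlift => h' y; split=> [x|h] c u v /=.
  by rewrite (linear_mulr h') scalerDr !scalerA mulrC.
by rewrite (linear_mulr _ c u v) counit_on_linear scalerDl scalerA.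
Qed.

Lemma admissible_functionals : admissible coidX e pi (functionals hopf GF).
Proof.
exists chi => //; split.
- exact: restricted_functional.
- exact: right_coideal_functionals.
- exact: functional_e.
- exact: functional1.
- by move=> i a; rewrite -partial_covariant; exact: valP.
Qed.

End CovariantCalculus.

(** * Calculi with the same d_i are isomorphic *)

Section Isomorphism.
Variables (K : fieldType) (H : algType K) (P : pred H) (X : subAlgType P).
Variables (M : nat) (e : 'I_M -> X) (G G' : fodc X).
Variables (GF : condF e G) (GF' : condF e G').

(** An isomorphism carries the expansion of da in the de^i to one of d'a in the d'e^i, and such an
    expansion is unique. *)
Lemma fodc_iso_partial : fodc_iso G G' ->
  forall i a, partial GF i a = partial GF' i a.
Proof.
move=> [phi [_ phil _ phid]] i a.
apply: (diff_basis_inj GF' (c := partial GF ^~ a)).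
rewrite -(partialE GF') -phid (partialE GF) linear_sum.
by apply: eq_bigr => j _; rewrite phil phid.
Qed.

(** The left X-linear map with de^i sent to d'e^i, the only candidate for an isomorphism. *)
Definition transfer (w : G) : G' := \sum_i lact (coeff GF w i) (diff G' (e i)).

Lemma transfer_linear : linear transfer.
Proof.
apply: linear_sum_fun => i c u v.
by rewrite coeff_linear (lact_linearl (diff G' (e i))).
Qed.

Lemma coeff_transfer w i : coeff GF' (transfer w) i = coeff GF w i.
Proof. exact: coeffP. Qed.

Lemma transfer_lact a w : transfer (lact a w) = lact a (transfer w).
Proof.
rewrite [RHS](linear_map_sum _ _ _ (lact_linear a)).
by apply: eq_bigr => i _; rewrite coeff_lact lactM.
Qed.

Hypothesis partial_eq : forall i a, partial GF i a = partial GF' i a.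

Lemma transfer_diff a : transfer (diff G a) = diff G' a.
Proof.
by rewrite (partialE GF'); apply: eq_bigr => i _; rewrite coeff_diff partial_eq.
Qed.

(** By left linearity it is enough to treat de^i, where [fodc_ractE] expresses the right action
    through d and the left action. *)
Lemma transfer_ract w b : transfer (ract w b) = ract (transfer w) b.
Proof.
have lB : {morph transfer : u v / u - v}.
  by have [g gE] := linear_pack transfer_linear => u v; rewrite -!gE linearB.
rewrite {1}(coeffE GF w) (linear_map_sum _ _ _ (ract_linear b)).
rewrite (linear_map_sum _ _ _ transfer_linear).
rewrite [RHS](linear_map_sum _ _ _ (ract_linear b)).
apply: eq_bigr => i _; rewrite !lractA transfer_lact; congr lact.
by rewrite !fodc_ractE lB transfer_lact !transfer_diff.
Qed.

End Isomorphism.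

(** The inverse is [transfer] in the other direction, because [transfer] preserves coefficients. *)
Lemma partial_fodc_iso (K : fieldType) (H : algType K) (P : pred H)
    (X : subAlgType P) (M : nat) (e : 'I_M -> X) (G G' : fodc X)
    (GF : condF e G) (GF' : condF e G') :
  (forall i a, partial GF i a = partial GF' i a) -> fodc_iso G G'.
Proof.
move=> E; have [phi phiE] := linear_pack (transfer_linear G' GF).
exists phi; split=> [|a w|w a|a].
- exists (transfer G GF') => w; rewrite phiE [LHS]/transfer.
    by under eq_bigr do rewrite coeff_transfer; rewrite -coeffE.
  by under eq_bigr do rewrite coeff_transfer; rewrite -coeffE.
- by rewrite !phiE transfer_lact.
- by rewrite !phiE (transfer_ract E).
- by rewrite phiE (transfer_diff E).
Qed.

(** The correspondence speaks of sets of functionals, and duality to e restores their labels: if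
    chi_i = chi'_j, evaluation at e^i forces j = i. *)
Lemma dual_family_unique (K : fieldType) (T : Type) (M : nat) (e : 'I_M -> T)
    (chi chi' : 'I_M -> T -> K^o) :
  (forall i j, chi i (e j) = (i == j)%:R) ->
  (forall i j, chi' i (e j) = (i == j)%:R) ->
  range chi = range chi' -> chi = chi'.
Proof.
move=> chiE chiE' rE; apply/funext => i.
have [j _ chij] : range chi' (chi i) by rewrite -rE; exists i.
have := chiE' j i; rewrite chij chiE eqxx.
case: eqP => [ji _|_ /eqP]; first by rewrite -chij ji.
by rewrite mulr0n oner_eq0.
Qed.

(** * From an admissible set of functionals to a covariant calculus *)

Section Construction.
Variables (K : fieldType) (H : algType K) (hopf : hopf_algebra H).
Variables (P : pred H) (X : subAlgType P) (coidX : left_coideal hopf X).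
Variables (M : nat) (e : 'I_M -> X) (pi : 'I_M -> 'I_M -> H).
Hypothesis piE : forall i, coaction coidX (e i) = \sum_j pi i j \ox e j.
Variable chi : 'I_M -> X -> K^o.
Hypothesis chi_linear : forall i, linear (chi i).
Hypothesis chi_e : forall i j, chi i (e j) = (i == j)%:R.
Hypothesis chi1 : forall i, chi i 1 = 0.

Local Notation eps := (counit_on hopf (X := X)).

(** The left legs of the coproduct of [f] are combinations of eps and the chi_i; collecting their
    coefficients with the right legs gives [F] and [F0]. *)
Lemma coideal_span_mul (f : rdual X) :
  right_coideal (Lin (eps |` range chi)) -> Lin (eps |` range chi) f ->
  exists (F : 'I_M -> X -> K) (F0 : X -> K), forall x y,
    f (x * y) = \sum_i chi i x * F i y + eps x * F0 y.
Proof.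
pose W := Lin (eps |` range chi).
pose U := [set g : X -> K^o | exists (c : 'I_M -> K) (c0 : K),
  forall x, g x = \sum_i chi i x * c i + eps x * c0].
have WU : W `<=` U.
  apply: Lin_min => [|_ [->|[j _ <-]]].
  - split=> [|a g g' [c [c0 gE]] [c' [c0' gE']]].
      exists (fun _ => 0), 0 => x; rewrite mulr0 addr0 big1 // => i _.
      by rewrite mulr0.
    exists (fun i => a * c i + c' i), (a * c0 + c0') => x.
    have -> : (a *: g + g') x = a * g x + g' x :> K by [].
    rewrite gE gE' !mulrDr addrACA mulrCA; congr (_ + _).
    rewrite mulr_sumr -big_split; apply: eq_bigr => i _ /=.
    by rewrite mulrDr mulrCA.
  - exists (fun _ => 0), 1 => x; rewrite mulr1 big1 ?add0r // => i _.
    by rewrite mulr0.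
  - by exists (fun i => (i == j)%:R), 0 => x; rewrite mulr0 addr0 sum_delta.
move=> [_ _ Wcom] /Wcom[t [tE St]].
pose S := [set t : tensor (rdual X) (rdual X) |
  exists (F : 'I_M -> X -> K) (F0 : X -> K), forall x y,
    tlift (fun g h : rdual X => (g x : K) *: h y : K^o) t =
    \sum_i chi i x * F i y + eps x * F0 y].
have lift_lin x y := tlift_linear (@bilinear_rdual K X x y).
suff: S t by case=> F [F0 tE']; exists F, F0 => x y; rewrite -tE tE'.
apply: (Lin_min _ _ St) => [|_ [w [g [Ww ->]]]].
  split=> [|a s s' [F [F0 sE]] [F' [F0' sE']]].
    exists (fun _ _ => 0), (fun _ => 0) => x y.
    rewrite (linear_map0 (lift_lin x y)) mulr0 addr0 big1 // => i _.
    by rewrite mulr0.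
  exists (fun i y => a * F i y + F' i y), (fun y => a * F0 y + F0' y) => x y.
  rewrite lift_lin sE sE' /GRing.scale /= !mulrDr addrACA mulrCA.
  congr (_ + _).
  rewrite mulr_sumr -big_split; apply: eq_bigr => i _ /=.
  by rewrite mulrDr mulrCA.
have [c [c0 wE]] := WU _ Ww.
exists (fun i y => c i * g y), (fun y => c0 * g y) => x y.
rewrite tlift_tens; last exact: bilinear_rdual.
rewrite wE [LHS]mulrDl mulrA; congr (_ + _).
by rewrite mulr_suml; apply: eq_bigr => i _; rewrite mulrA.
Qed.

Hypothesis chi_restricted : forall i, restricted (chi i).
Hypothesis chi_coideal : right_coideal (Lin (eps |` range chi)).

Lemma coideal_mul : exists f : 'I_M -> 'I_M -> X -> K^o, forall j x y,
  chi j (x * y) = \sum_i chi i x * f i j y + eps x * chi j y.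
Proof.
have dec j : exists F : 'I_M -> X -> K^o, forall x y,
    chi j (x * y) = \sum_i chi i x * F i y + eps x * chi j y.
  have [r rE] := rdual_of (chi_restricted j).
  have Wr : Lin (eps |` range chi) r.
    by apply: Lin_subset; rewrite rE; right; exists j.
  have [F [F0 FE]] := coideal_span_mul chi_coideal Wr.
  exists F => x y; rewrite -rE FE; congr (_ + _ * _).
  (* At x = 1 every chi_i vanishes and eps is 1, which identifies [F0] with chi_j. *)
  have := FE 1 y; rewrite mul1r counit_on1 mul1r => ->.
  by rewrite big1 ?add0r // => i _; rewrite chi1 mul0r.
exists (fun i j => sval (cid (dec j)) i) => j x y.
by case: cid.
Qed.

Variable d : 'I_M -> X -> X.
Hypothesis dE : forall i a, val (d i a) = partial_of coidX pi chi i a.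

Lemma d_linear i : linear (d i).
Proof.
move=> c u v; apply: val_inj; rewrite (@val_linear _ _ _ X) !dE.
exact: partial_of_linear.
Qed.

Lemma d_e i k : d i (e k) = (k == i)%:R.
Proof.
apply: val_inj; rewrite [LHS]dE (partial_of_e piE) //.
by rewrite (rmorph_nat (val : {rmorphism X -> H})).
Qed.

Lemma d1 i : d i 1 = 0.
Proof.
apply: val_inj; rewrite [LHS]dE partial_of1 //.
by rewrite (rmorph0 (val : {rmorphism X -> H})).
Qed.

(** The t^i_j of (2), now with values in X. *)
Definition d_twist i j (b : X) : X := d j (e i * b) - e i * d j b.

Lemma dM j a b : d j (a * b) = \sum_i d i a * d_twist i j b + a * d j b.
Proof.
have [f fE] := coideal_mul.
apply: val_inj; rewrite [LHS]dE (partial_ofM piE chi_linear chi_e fE).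
pose v := (val : {rmorphism X -> H}).
have vE i' a' : v (d i' a') = partial_of coidX pi chi i' a' := dE i' a'.
rewrite (rmorphD v) (rmorphM v) (rmorph_sum v) vE; congr (_ + _).
apply: eq_bigr => i _; rewrite (rmorphM v) vE; congr (_ * _).
by rewrite (rmorphB v) (rmorphM v) !vE.
Qed.

Lemma d_twist_linear i j : linear (d_twist i j).
Proof.
move=> c u v; rewrite /d_twist linear_mull !d_linear linear_mull.
by rewrite scalerBr opprD addrACA.
Qed.

Lemma d_twist1 i j : d_twist i j 1 = (i == j)%:R.
Proof. by rewrite /d_twist mulr1 d_e d1 mulr0 subr0. Qed.

(* Both sides arise from expanding d_j (e_i a b) by dM in two ways. *)
Lemma d_twistM i j a b :
  d_twist i j (a * b) = \sum_k d_twist i k a * d_twist k j b.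
Proof.
rewrite {1}/d_twist mulrA !dM mulrDr opprD addrACA mulrA subrr addr0.
rewrite mulr_sumr -sumrB; apply: eq_bigr => k _.
by rewrite /d_twist mulrBl mulrA.
Qed.

(** The free left module X^M of row vectors; by [d_e] the de^i are its standard basis. The right
    action of b below is multiplication by the matrix t(b). *)
Let Gamma : lmodType K := {ffun 'I_M -> X}.

Definition free_lact (a : X) (w : Gamma) : Gamma := [ffun i => a * w i].
Definition free_ract (w : Gamma) (b : X) : Gamma :=
  [ffun j => \sum_i w i * d_twist i j b].

Lemma free_lact_bilinear : bilinear_map free_lact.
Proof.
split=> [w|a] c x y; apply/ffunP => i; rewrite !ffunE.
  exact: linear_mulr.
exact: linear_mull.
Qed.

Lemma free_ract_bilinear : bilinear_map free_ract.
Proof.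
split=> [b|w] c x y; apply/ffunP => i; rewrite !ffunE scaler_sumr -big_split /=;
  apply: eq_bigr => j _; rewrite ?ffunE.
  exact: linear_mulr.
by rewrite d_twist_linear linear_mull.
Qed.

Lemma free_lact1 w : free_lact 1 w = w.
Proof. by apply/ffunP => i; rewrite ffunE mul1r. Qed.

Lemma free_ract1 w : free_ract w 1 = w.
Proof.
apply/ffunP => j; rewrite ffunE.
by under eq_bigr do rewrite d_twist1; rewrite sum_delta.
Qed.

Lemma free_lactM a b w : free_lact (a * b) w = free_lact a (free_lact b w).
Proof. by apply/ffunP => i; rewrite !ffunE mulrA. Qed.

Lemma free_ractM a b w : free_ract w (a * b) = free_ract (free_ract w a) b.
Proof.
apply/ffunP => j; rewrite !ffunE.
under eq_bigr do rewrite d_twistM mulr_sumr.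
rewrite exchange_big; apply: eq_bigr => k _ /=; rewrite ffunE mulr_suml.
by apply: eq_bigr => i _; rewrite mulrA.
Qed.

Lemma free_lractA a w b :
  free_ract (free_lact a w) b = free_lact a (free_ract w b).
Proof.
apply/ffunP => j; rewrite !ffunE mulr_sumr.
by apply: eq_bigr => i _; rewrite ffunE mulrA.
Qed.

Definition free_bimodule : bimodule X :=
  Bimodule free_lact_bilinear free_ract_bilinear free_lact1 free_ract1
    free_lactM free_ractM free_lractA.

Definition free_diff_fun (a : X) : Gamma := [ffun i => d i a].

Lemma free_diff_linear : linear free_diff_fun.
Proof. by move=> c u v; apply/ffunP => i; rewrite !ffunE d_linear. Qed.

HB.instance Definition _ :=
  GRing.isLinear.Build K X Gamma _ free_diff_fun free_diff_linear.
Definition free_diff : {linear X -> free_bimodule} := free_diff_fun.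

Lemma free_diffM a b :
  free_diff (a * b) =
  ract (free_diff a : free_bimodule) b + lact a (free_diff b : free_bimodule).
Proof.
apply/ffunP => j; rewrite /= !ffunE dM; congr (_ + _).
by apply: eq_bigr => i _; rewrite ffunE.
Qed.

Lemma free_sum (c : 'I_M -> X) :
  [ffun i => c i] = \sum_i free_lact (c i) (free_diff (e i)) :> Gamma.
Proof.
apply/ffunP => j; rewrite ffunE sum_ffunE.
under eq_bigr do rewrite !ffunE d_e.
by rewrite sum_delta.
Qed.

Lemma free_span w :
  Lin [set v : free_bimodule | exists a b, v = lact a (free_diff b)] w.
Proof.
have -> : w = \sum_i free_lact (w i) (free_diff (e i)).
  by rewrite -(free_sum w); apply/ffunP => i; rewrite ffunE.
under eq_bigr do rewrite -[free_lact _ _]scale1r.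
apply: subspace_sum => [|i]; first exact: subspace_Lin.
by apply: Lin_subset; exists (w i), (e i).
Qed.

Definition free_fodc : fodc X := Fodc free_diffM free_span.

Lemma free_diff_coord (a : X) (c : 'I_M -> X) :
  diff free_fodc a = \sum_i lact (c i) (diff free_fodc (e i)) ->
  forall i, c i = d i a.
Proof.
move=> cE i; have : [ffun i => d i a] = [ffun i => c i] :> Gamma.
  by rewrite [RHS]free_sum; exact: cE.
by move/ffunP/(_ i); rewrite !ffunE.
Qed.

Lemma free_condF : condF e free_fodc.
Proof.
move=> a; exists [ffun i => d i a]; split.
  by under eq_bigr do rewrite ffunE; exact: free_sum.
by move=> c cE; apply/ffunP => i; rewrite ffunE (free_diff_coord cE).
Qed.

Lemma free_partial (GF : condF e free_fodc) i a : partial GF i a = d i a.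
Proof. by apply: (free_diff_coord (c := partial GF ^~ a)); exact: partialE. Qed.

(** The counit of d_i(a) is chi_i(a), so the construction returns the functionals it started
    from. *)
Lemma free_functionals (GF : condF e free_fodc) :
  functionals hopf GF = range chi.
Proof.
suff E : (fun i => eps \o partial GF i) = chi by rewrite /functionals E.
apply/funext => i; apply/funext => a /=.
by rewrite free_partial /counit_on dE (counit_partial_of piE).
Qed.

Definition single (k : 'I_M) (x : X) : free_fodc :=
  lact x (diff free_fodc (e k)).

Lemma single_linear k : linear (single k).
Proof. exact: lact_linearl. Qed.

Lemma lact_diff_single x y :
  lact x (diff free_fodc y) = \sum_k single k (x * d k y).
Proof.
rewrite (partialE free_condF) (linear_map_sum _ _ _ (lact_linear x)).
by apply: eq_bigr => k _; rewrite free_partial -lactM.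
Qed.

(** On x de^i this is the sum over k of x_(1) pi^i_k \ox x_(2) de^k, the value that covariance
    prescribes. *)
Definition free_coact (w : free_fodc) : tensor H free_fodc :=
  \sum_i \sum_k tlift (fun h x => (h * pi i k) \ox single k x)
    (coaction coidX ((w : Gamma) i)).

Lemma free_coact_linear : linear free_coact.
Proof.
apply: linear_sum_fun => i; apply: linear_sum_fun => k c u v.
rewrite ffunE ffunE coaction_linear tlift_linear //.
by apply: bilinear_tmap; [exact: linear_mulr | exact: single_linear].
Qed.

(** The i-th coordinate of a db is a d_i(b). After the coaction is split over this product,
    [coaction_partial] turns the sum over i into b_(1) \ox d_k(b_(2)), and the sum over k
    reassembles db_(2). *)
Lemma free_covariant : covariant coidX free_fodc.
Proof.
have [D DE] := linear_pack free_coact_linear; exists D => a b; rewrite DE.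
have lsingle := single_linear.
rewrite /free_coact exchange_big.
transitivity (\sum_k tlift (fun h x => tlift (fun h' y =>
    (h * h') \ox single k (x * d k y)) (coaction coidX b)) (coaction coidX a)).
  apply: eq_bigr => k _.
  transitivity (\sum_i tlift (fun h x => tlift (fun h' y =>
      (h * h' * pi i k) \ox single k (x * y)) (coaction coidX (d i b)))
      (coaction coidX a)).
    apply: eq_bigr => i _; rewrite !ffunE tlift_coactionM //.
    by apply: bilinear_tmap; [exact: linear_mulr | exact: single_linear].
  rewrite -tlift_sum; apply: eq_tlift => h x.
  have bC : bilinear_map (fun g y => (h * g) \ox single k (x * y)).
    apply: bilinear_tmap; first exact: linear_mull.
    by move=> c u v; rewrite linear_mull single_linear.
  (* [coaction_partial] is multiplied on the left by [h] in the first leg and by [x] in the second,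
     and the second leg is then placed in coordinate k. *)
  have := congr1 (tlift (fun g y => (h * g) \ox single k (x * y)))
    (coaction_partial piE chi_linear chi_e dE k b).
  rewrite (linear_map_sum _ _ _ (tlift_linear bC)).
  under eq_bigr do rewrite tlift_tlift //.
  rewrite tlift_tlift // => E.
  under [RHS]eq_tlift do rewrite -(tlift_tens bC).
  rewrite -E; apply: eq_bigr => i _; apply: eq_tlift => h' y.
  by rewrite tlift_tens // mulrA.
rewrite -tlift_sum; apply: eq_tlift => h x.
rewrite -tlift_sum; apply: eq_tlift => h' y.
by rewrite -tens_sumr lact_diff_single.
Qed.

End Construction.

(** * The correspondence *)

Lemma admissible_realised (K : fieldType) (H : algType K)
    (hopf : hopf_algebra H) (P : pred H) (X : subAlgType P)
    (coidX : left_coideal hopf X) (M : nat) (e : 'I_M -> X)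
    (pi : 'I_M -> 'I_M -> H) (W : set (X -> K^o)) :
  (forall i, coaction coidX (e i) = \sum_j pi i j \ox e j) ->
  admissible coidX e pi W ->
  exists (G : fodc X) (GF : condF e G),
    covariant coidX G /\ functionals hopf GF = W.
Proof.
move=> piE [chi -> [chi_r chi_c chi_e chi1 chiP]].
have chi_l i : linear (chi i) := (chi_r i).1.
(* The last condition of admissibility allows the d_i to be taken with values in X. *)
pose d i a := Sub (partial_of coidX pi chi i a) (chiP i a) : X.
have dE i a : val (d i a) = partial_of coidX pi chi i a by rewrite SubK.
exists (free_fodc piE chi_l chi_e chi1 chi_r chi_c dE).
exists (free_condF piE chi_l chi_e chi1 chi_r chi_c dE); split.
  exact: free_covariant.
exact: free_functionals.
Qed.

(** The first clause says that the assignment lands among the admissible sets, the second that it is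
    well defined and injective on isomorphism classes, the third that it is surjective. *)
Theorem theorem1 (R : realType) (H : algType R[i]) (hopf : hopf_algebra H)
    (P : pred H) (X : subAlgType P) (coidX : left_coideal hopf X)
    (V : set X) (comodV : subcomodule coidX V)
    (M : nat) (e : 'I_M -> X) (basis_e : is_basis V e)
    (pi : 'I_M -> 'I_M -> H)
    (piE : forall i, coaction coidX (e i) = \sum_j pi i j \ox e j) :
  [/\ forall (G : fodc X) (GF : condF e G), covariant coidX G ->
        admissible coidX e pi (functionals hopf GF),
      forall (G G' : fodc X) (GF : condF e G) (GF' : condF e G'),
        covariant coidX G -> covariant coidX G' ->
        fodc_iso G G' <-> functionals hopf GF = functionals hopf GF' &
      forall W : set (X -> R[i]^o), admissible coidX e pi W ->
        exists (G : fodc X) (GF : condF e G),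
          covariant coidX G /\ functionals hopf GF = W].
Proof.
split=> [G GF covG|G G' GF GF' covG covG'|W]; last exact: admissible_realised.
  exact: admissible_functionals.
split=> [iso|funE].
  suff E : partial GF = partial GF' by rewrite /functionals E.
  by apply/funext => i; apply/funext => a; exact: fodc_iso_partial.
(* Both calculi have their d_i given by the same formula in their functionals, and equal sets of
   functionals give equal families. *)
apply: (partial_fodc_iso (GF := GF) (GF' := GF')) => i a; apply: val_inj.
rewrite !(partial_covariant piE) //; congr (partial_of _ _ _ _ _).
by apply: (dual_family_unique (e := e)) => //; exact: functional_e.
Qed.
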